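(* For every $r\in\{1,\infty\}$ and every $N\in\{0,2,3,\ldots\}$, the set $$\mathcal{F}_{r,N}=\left\{\lambda\in\mathfrak{M}_r(\Gamma_N)\mid \widehat{(\Gamma_N,\lambda)}\text{ is isometrically group-isomorphic to }\mathbb{G}_r(N)\right\}$$ is dense and comeager in $\mathfrak{M}_r(\Gamma_N)$.
   Context: All groups are written additively. A value on a group $G$ is a function $p\colon G\to[0,\infty)$ with $p(x)=0\iff x=0$, $p(-x)=p(x)$, and $p(x+y)\le p(x)+p(y)$ for all $x,y\in G$. A value induces the metric $d_p(x,y)=p(x-y)$, and metric and topological notions for a valued group $(G,p)$ refer to $d_p$. For Abelian $G$, $\widehat{(G,p)}$ denotes the completion of $G$ with respect to $d_p$, with the extended group operation and the extended value. Isometric group homomorphisms, embeddings and isomorphisms are group homomorphisms, embeddings and isomorphisms preserving the values. A valued Abelian group $(G,p)$ is of class $\mathcal{O}_0$ if $\lim_{n\to\infty}p(nx)/n=0$ for every $x\in G$. Let $\mathfrak{G}_\infty(0)$ be the class of all separable valued Abelian groups of class $\mathcal{O}_0$, and $\mathfrak{G}_1(0)$ the subclass of those $(G,p)$ with $p\le 1$. For $N\ge 2$, let $\mathfrak{G}_\infty(N)$ be the subclass of $\mathfrak{G}_\infty(0)$ of groups of exponent dividing $N$ (i.e. $Nx=0$ for all $x$), and $\mathfrak{G}_1(N)=\mathfrak{G}_\infty(N)\cap\mathfrak{G}_1(0)$. For $r\in\{1,\infty\}$ and $N\in\{0,2,3,\ldots\}$, $\mathbb{G}_r(N)$ denotes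 the valued Abelian group which is unique, up to isometric group isomorphism, with the following properties (its existence and uniqueness is a theorem of Niemiec): (1) $\mathbb{G}_r(N)$ is complete and belongs to $\mathfrak{G}_r(N)$; (2) every finite valued group in $\mathfrak{G}_r(N)$ admits an isometric group embedding into $\mathbb{G}_r(N)$; (3) every isometric group homomorphism between two finite subgroups of $\mathbb{G}_r(N)$ extends to an isometric group homomorphism of $\mathbb{G}_r(N)$ onto itself; (4) if $N=0$, the elements of finite order form a dense subgroup of $\mathbb{G}_r(N)$. Let $\Gamma_0=\bigoplus_{n\in\mathbb{N}}\mathbb{Q}/\mathbb{Z}$ and $\Gamma_N=\bigoplus_{n\in\mathbb{N}}\mathbb{Z}/N\mathbb{Z}$ for $N\ge2$. For a countable Abelian group $G$, $\mathfrak{M}_\infty(G)\subseteq[0,\infty)^G$ is the space of all values on $G$ and $\mathfrak{M}_1(G)\subseteq[0,1]^G$ the space of all values on $G$ bounded by $1$, each with the subspace topology of the product topology (these are Polish spaces). *)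

(* Defs.v *)
From HB Require Import structures.
From mathcomp Require Import all_boot all_order all_algebra.
From mathcomp Require Import all_classical all_reals all_analysis.

Set Implicit Arguments.
Unset Strict Implicit.
Unset Printing Implicit Defensive.

Import Order.TTheory GRing.Theory Num.Theory.
Import numFieldNormedType.Exports.

Local Open Scope classical_set_scope.
Local Open Scope ring_scope.

Record is_value (R : realType) (G : zmodType) (p : G -> R) : Prop := IsValue {
  is_value_ge0 : forall x, 0 <= p x;
  is_value_eq0 : forall x, p x = 0 <-> x = 0;
  is_valueN : forall x, p (- x) = p x;
  is_valueD : forall x y, p (x + y) <= p x + p y
}.

HB.mixin Record Zmodule_isValued (R : realType) G of GRing.Zmodule G := {
  value : G -> R;
  value_is_value : is_value value
}.

#[short(type="valuedZmodType")]
HB.structure Definition ValuedZmodule (R : realType) :=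
  {G of Zmodule_isValued R G & GRing.Zmodule G}.

Section value_theory.
Variables (R : realType) (V : valuedZmodType R).
Implicit Types x y z : V.

Lemma value_eq0 x : value x = 0 :> R <-> x = 0.
Proof. exact: is_value_eq0 (@value_is_value R V) x. Qed.

Lemma value0 : value (0 : V) = 0 :> R.
Proof. exact/value_eq0. Qed.

Lemma value_ge0 x : 0 <= value x :> R.
Proof. exact: is_value_ge0 (@value_is_value R V) x. Qed.

Lemma valueN x : value (- x) = value x :> R.
Proof. exact: is_valueN (@value_is_value R V) x. Qed.

Lemma valueD x y : value (x + y) <= value x + value y :> R.
Proof. exact: is_valueD (@value_is_value R V) x y. Qed.

Lemma valueBC x y : value (x - y) = value (y - x) :> R.
Proof. by rewrite -valueN opprB. Qed.

Lemma value_dist x y : `|value x - value y| <= value (x - y) :> R.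
Proof.
have h z t : value z <= value (z - t) + value t :> R.
  by rewrite -{1}(subrK t z) valueD.
by rewrite ler_norml lerBlDr h andbT lerNl opprB lerBlDr valueBC h.
Qed.

End value_theory.

(* The carrier of [V], seen as the metric space with metric d_p(x,y) = p(x-y).
   The alias is needed because the library does not relate its metric spaces
   to groups that are not normed modules. *)
Section metric_of.
Variables (R : realType) (V : valuedZmodType R).

Definition metric_of : Type := V.

Let dist (x y : V) : R := value (x - y).

Let distxx x : dist x x = 0.
Proof. by rewrite /dist subrr value0. Qed.

Let dist_positivity x y : dist x y = 0 -> x = y.
Proof. by move=> /value_eq0/eqP; rewrite subr_eq0 => /eqP. Qed.

Let dist_sym x y : dist x y = dist y x.
Proof. exact: valueBC. Qed.

Let dist_triangle y x z : dist x z <= dist x y + dist y z.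
Proof. by rewrite /dist -(subrKA y) valueD. Qed.

HB.instance Definition _ := Choice.on metric_of.
HB.instance Definition _ := @isMetric.Build R metric_of
  dist distxx dist_positivity dist_sym dist_triangle.

End metric_of.

Section valued_by.
Variables (R : realType) (G : zmodType) (p : G -> R) (vp : is_value p).

Definition valued_by of is_value p : Type := G.

HB.instance Definition _ := GRing.Zmodule.on (valued_by vp).

Let is_value_valued_by : @is_value R (valued_by vp) p.
Proof. by case: vp => *; split. Qed.

HB.instance Definition _ :=
  Zmodule_isValued.Build R (valued_by vp) is_value_valued_by.

End valued_by.

Section completion.
Variables (R : realType) (V : valuedZmodType R).
Implicit Types u v : nat -> V.

Definition cauchy_seq : {pred nat -> V} :=
  fun u => `[< cauchy ((u n : metric_of V) @[n --> \oo]) >].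

Lemma cauchy_seqP u : reflect
  (forall e : R, 0 < e ->
    exists N, forall m n, (N <= m)%N -> (N <= n)%N -> value (u m - u n) < e)
  (u \in cauchy_seq).
Proof.
apply: (iffP (asboolP _)) => [/cauchy_ballP cu e e0|cu].
  have [[A B] /= [[N1 _ hN1] [N2 _ hN2]] AB] := cu _ e0.
  exists (maxn N1 N2) => m n; rewrite !geq_max => /andP[m1 m2] /andP[n1 n2].
  have := AB (u m, u n) (conj (hN1 _ m1) (hN2 _ n2)).
  by rewrite /= ballEmdist.
apply/cauchy_ballP => e e0; have [N hN] := cu _ e0.
exists (u @` [set n | (N <= n)%N], u @` [set n | (N <= n)%N]) => /=.
  by split; exists N => // n Nn; exists n.
by move=> [_ _] /= [[m Nm <-] [n Nn <-]]; rewrite ballEmdist; exact: hN.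
Qed.

Fact cauchy_seq_zmod_closed : zmod_closed cauchy_seq.
Proof.
split=> [|u v /cauchy_seqP cu /cauchy_seqP cv]; apply/cauchy_seqP => e e0.
  by exists 0%N => m n _ _; rewrite subrr value0.
have e20 : 0 < e / 2 by rewrite divr_gt0.
have [M hM] := cu _ e20; have [N hN] := cv _ e20.
exists (maxn M N) => m n; rewrite !geq_max => /andP[Mm Nm] /andP[Mn Nn].
rewrite (_ : (u - v) m - (u - v) n = (u m - u n) - (v m - v n)); last first.
  by rewrite !opprB addrACA [RHS]addrACA (addrC (- v m)).
rewrite (le_lt_trans (valueD _ _))// valueN (splitr e) ltrD//.
  exact: hM.
exact: hN.
Qed.

HB.instance Definition _ :=
  GRing.isZmodClosed.Build (nat -> V) cauchy_seq cauchy_seq_zmod_closed.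

Record cauchy_group := CauchyGroup {
  cauchy_val :> nat -> V;
  _ : cauchy_val \in cauchy_seq
}.

HB.instance Definition _ := [isSub for cauchy_val].
HB.instance Definition _ := [Choice of cauchy_group by <:].
HB.instance Definition _ := [SubChoice_isSubZmodule of cauchy_group by <:].

Definition null_seq : {pred cauchy_group} :=
  fun u : cauchy_group => `[< value (u n) @[n --> \oo] --> (0 : R) >].

Fact null_seq_zmod_closed : zmod_closed null_seq.
Proof.
split=> [|u v /asboolP u0 /asboolP v0]; apply/asboolP.
  rewrite (_ : (fun n => _) = cst 0); first exact: cvg_cst.
  by apply/funext => n; rewrite /= value0.
have uv0 := cvgD (FF := eventually_filter) u0 v0; rewrite addr0 in uv0.
refine (squeeze_cvgr _ (cvg_cst 0) uv0).
by apply: nearW => n /=; rewrite value_ge0 /= (le_trans (valueD _ _))// valueN.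
Qed.

HB.instance Definition _ :=
  GRing.isZmodClosed.Build cauchy_group null_seq null_seq_zmod_closed.

Definition completion : Type := Quotient.quot null_seq.

HB.instance Definition _ := GRing.Zmodule.on completion.

Definition completion_value (x : completion) : R :=
  lim (value (cauchy_val (repr x) n) @[n --> \oo]).

Lemma cvg_value (u : cauchy_group) : cvgn (fun n => value (u n) : R).
Proof.
apply/cauchy_cvgP/cauchy_ballP => e e0.
have /cauchy_seqP/(_ _ e0)[N hN] := valP u.
exists ((fun n => value (u n) : R) @` [set n | (N <= n)%N],
  (fun n => value (u n) : R) @` [set n | (N <= n)%N]) => /=.
  by split; exists N => // n Nn; exists n.
move=> [_ _] /= [[m Nm <-] [n Nn <-]].
by rewrite /ball /= (le_lt_trans (value_dist _ _))// hN.
Qed.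

Lemma completion_valueE (u : cauchy_group) :
  completion_value (\pi_completion u)%qT = lim (value (u n) @[n --> \oo]).
Proof.
rewrite /completion_value.
set v := repr _.
have uv : u - v \in null_seq.
  by rewrite Quotient.idealrBE reprK.
have {}uv : value (u n - v n) @[n --> \oo] --> (0 : R) by exact/asboolP.
have /cvg_lim <-// : value (v n) @[n --> \oo] --> lim (value (u n) @[n --> \oo]).
have cu := @cvg_value u.
apply/cvgrPdist_lt => e e0.
have e20 : 0 < e / 2 by rewrite divr_gt0.
near=> n.
rewrite (splitr e) -(subrKA (value (u n))) (le_lt_trans (ler_normD _ _))//.
rewrite ltrD//.
  by near: n; exact: cvgr_dist_lt cu _ e20.
rewrite (le_lt_trans (value_dist _ _))// -[ltLHS]ger0_norm ?value_ge0//.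
rewrite -normrN -[X in `|X|]add0r.
by near: n; exact: cvgr_dist_lt uv _ e20.
Unshelve. all: by end_near. Qed.

Lemma cvg_completion_value (u : cauchy_group) :
  value (u n) @[n --> \oo] --> completion_value (\pi_completion u)%qT.
Proof. by rewrite completion_valueE; exact: cvg_value. Qed.

Lemma completion_pi0P (u : cauchy_group) :
  (\pi_completion u)%qT = 0 <-> value (u n) @[n --> \oo] --> (0 : R).
Proof.
rewrite -(@pi_zeror _ _ _ _ _ (Quotient.quot null_seq)).
split=> [/eqP|u0]; first by rewrite -Quotient.idealrBE subr0 => /asboolP.
by apply/eqP; rewrite -Quotient.idealrBE subr0; exact/asboolP.
Qed.

Fact completion_is_value : is_value completion_value.
Proof.
split=> [x|x|x|x y].
- rewrite -[x]reprK.
  refine (ler_cvg_to (cvg_cst 0) (@cvg_completion_value (repr x)) _).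
  by exists 0%N => // n _; exact: value_ge0.
- rewrite -[x]reprK; set u := repr x.
  have cu := @cvg_completion_value u.
  split=> [u0|/completion_pi0P u0]; last exact: cvg_unique cu u0.
  by apply/completion_pi0P; rewrite -u0.
- rewrite -[x]reprK; set u := repr x.
  rewrite -(@pi_oppr _ _ _ _ _ (Quotient.quot null_seq)) !completion_valueE.
  suff -> : (fun n => value ((- u) n) : R) = (fun n => value (u n)) by [].
  by apply/funext => n; exact: valueN.
- rewrite -[x]reprK -[y]reprK; set u := repr x; set v := repr y.
  rewrite -(@pi_addr _ _ _ _ _ (Quotient.quot null_seq)).
  have cuv := cvgD (FF := eventually_filter) (@cvg_completion_value u)
    (@cvg_completion_value v).
  apply: (ler_cvg_to (@cvg_completion_value (u + v)) cuv).
  by exists 0%N => // n _; exact: valueD.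
Qed.

HB.instance Definition _ :=
  Zmodule_isValued.Build R completion completion_is_value.

End completion.

Definition isometric (R : realType) (G H : valuedZmodType R) (f : G -> H) :=
  forall x, value (f x) = value x.

Definition isometrically_isomorphic (R : realType) (G H : valuedZmodType R) :=
  exists2 f : {additive G -> H}, bijective f & isometric f.

Definition isometrically_embeds (R : realType) (G H : valuedZmodType R) :=
  exists2 f : {additive G -> H}, injective f & isometric f.

Section direct_sum.
Variable A : zmodType.

Definition finitely_supported : {pred nat -> A} :=
  fun f => `[< finite_set [set n | f n <> 0] >].

Fact finitely_supported_zmod_closed : zmod_closed finitely_supported.
Proof.
split=> [|f g /asboolP fF /asboolP gF]; apply/asboolP.
  by rewrite (_ : [set n | _] = set0) //; apply/seteqP; split=> n //=; apply.
apply: (@sub_finite_set _ _ ([set n | f n <> 0] `|` [set n | g n <> 0]));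
  last by rewrite finite_setU.
move=> n /=; apply: contra_notP => /not_orP[/contrapT fn0 /contrapT gn0].
by rewrite -[LHS]/(f n - g n) fn0 gn0 subr0.
Qed.

HB.instance Definition _ := GRing.isZmodClosed.Build (nat -> A)
  finitely_supported finitely_supported_zmod_closed.

Record countable_sum := CountableSum {
  countable_sum_val :> nat -> A;
  _ : countable_sum_val \in finitely_supported
}.

HB.instance Definition _ := [isSub for countable_sum_val].
HB.instance Definition _ := [Choice of countable_sum by <:].
HB.instance Definition _ := [SubChoice_isSubZmodule of countable_sum by <:].

End direct_sum.

Definition integral_rat : {pred rat} := fun x => x \is a Num.int.

Fact integral_rat_zmod_closed : zmod_closed integral_rat.
Proof. by split=> [|x y]; [exact: rpred0|exact: rpredB]. Qed.

HB.instance Definition _ :=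
  GRing.isZmodClosed.Build rat integral_rat integral_rat_zmod_closed.

Definition rat_mod_int : zmodType := Quotient.quot integral_rat.

(* ['Z_N] is the integers mod N only for N >= 2; the value at N = 1 is
   irrelevant. *)
Definition Gamma (N : nat) : zmodType :=
  if N is 0%N then countable_sum rat_mod_int else countable_sum 'Z_N.

Definition separable_space (T : topologicalType) :=
  exists2 D : set T, countable D & dense D.

(* The library's [completeType] without the choice of a distinguished point. *)
Definition complete_space (T : uniformType) :=
  forall F : set_system T, ProperFilter F -> cauchy F -> exists l : T, F --> l.

(* The bound [r] is meant to be [1%E] or [+oo%E]. For N = 0 the condition on
   the exponent reads 0 = 0 and is void. *)
Record in_class (R : realType) (r : \bar R) (N : nat) (V : valuedZmodType R) :
    Prop := InClass {
  in_class_separable : separable_space (metric_of V);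
  in_class_O0 : forall x : V, value (x *+ n) / n%:R @[n --> \oo] --> (0 : R);
  in_class_bound : forall x : V, ((value x : R)%:E <= r)%E;
  in_class_exponent : forall x : V, x *+ N = 0
}.

Definition is_subgroup (V : zmodType) (A : set V) :=
  A 0 /\ forall x y, A x -> A y -> A (x - y).

(* The homomorphism between the finite subgroups [A] and [B] is represented by
   a function on the whole group, whose values outside [A] are irrelevant. *)
Definition extends_finite_isometries (R : realType) (V : valuedZmodType R) :=
  forall (A B : set V) (f : V -> V),
    is_subgroup A -> finite_set A -> is_subgroup B -> finite_set B ->
    (forall x, A x -> B (f x)) ->
    (forall x y, A x -> A y -> f (x + y) = f x + f y) ->
    (forall x, A x -> value (f x) = value x :> R) ->
  exists g : {additive V -> V},
    [/\ isometric g, (forall y, exists x, g x = y) &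
        forall x, A x -> g x = f x].

Definition finite_order (V : zmodType) : set V :=
  [set x | exists2 n, (0 < n)%N & x *+ n = 0].
Arguments finite_order V _ : clear implicits.

(* The defining properties of the universal group G_r(N). *)
Record is_GrN (R : realType) (r : \bar R) (N : nat) (V : valuedZmodType R) :
    Prop := IsGrN {
  is_GrN_complete : complete_space (metric_of V);
  is_GrN_class : in_class r N V;
  is_GrN_universal : forall H : valuedZmodType R,
    finite_set [set: H] -> in_class r N H -> isometrically_embeds H V;
  is_GrN_homogeneous : extends_finite_isometries V;
  is_GrN_torsion : N = 0%N -> dense (finite_order V : set (metric_of V))
}.

(* The topology on the set of values is that of [set_type], i.e. the one
   induced by the product topology of [{ptws G -> R}]. *)
Definition values (R : realType) (r : \bar R) (G : zmodType) :
    set {ptws G -> R} :=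
  [set p : {ptws G -> R} | is_value p /\ forall x, ((p x)%:E <= r)%E].

Arguments values {R} r G _.

Section valued_by_space.
Variables (R : realType) (r : \bar R) (G : zmodType) (p : values r G).

Fact values_is_value : is_value (set_val p : {ptws G -> R}).
Proof. by have [] := set_valP p. Qed.

Definition valued : valuedZmodType R := valued_by values_is_value.

End valued_by_space.

Definition nowhere_dense (T : topologicalType) (A : set T) :=
  (closure A)° = set0.

Definition meager (T : topologicalType) (A : set T) :=
  exists2 B : (set T)^nat,
    (forall n, nowhere_dense (B n)) & A = \bigcup_n B n.

Definition comeager (T : topologicalType) (A : set T) := meager (~` A).

(* Main.v *)
From HB Require Import structures.
Require Import Defs.
From mathcomp Require Import all_boot all_order all_algebra.
From mathcomp Require Import finmap.
From mathcomp Require Import all_classical all_reals all_analysis.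
From mathcomp Require Import lra.

Import Order.TTheory GRing.Theory Num.Theory.
Import numFieldNormedType.Exports.

Local Open Scope classical_set_scope.
Local Open Scope ring_scope.

Set Implicit Arguments.
Unset Strict Implicit.

(** Write [G] for the countable torsion group Gamma_N and [V] for the given
    universal group. If [(G, lam)] has an isometric homomorphism into [V] with
    dense image, then the completion of [(G, lam)] is isometrically isomorphic
    to [V] ([completion_iso]). So it suffices to find countably many open
    conditions on [lam] that can be met densely and that together yield such a
    homomorphism.

    Two extension facts drive the proof, and both come from one formula. Let
    [S] be a finite subgroup of [G * V] with [|lam x - value v| <= e] for all
    [(x, v)] in [S]: it is an approximate isometry between finite groups. The
    inf-convolution, which sends [z] to the minimum over [k] in [S] of
    [p (z - f k) + s k], is again a value ([inf_convolution]), and it glues the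
    two sides of [S] together.
    - Inside [V], gluing followed by the exact extension property of [V]
      ([is_GrN_extend]) replaces the approximate isometry by an exact isometric
      homomorphism that differs from it by at most [e] ([is_GrN_amalgam]).
    - Inside [G], gluing along a new element [x], independent of a given finite
      subgroup [E], changes [lam] only outside [E] and lets [x] behave over
      a smaller subgroup like a prescribed element [d] of finite order of [V]
      behaves over a copy of that subgroup ([realization]).

    Exhaust [G] by a chain of finite subgroups. The condition [forced] says: if
    [lam] on the [n]-th subgroup agrees up to [e] with a table [c], and [c]
    agrees up to [e] with the values of the elements [phi a + d *+ k] of [V],
    then some [x] in [G] makes [lam (a + x *+ k)] agree with the table up to
    [4 * e]. Rational tables are enough, hence countably many conditions. Each
    one is open, since it is witnessed by finitely many values of [lam]
    ([forced_open]), and by [realization] it can be met without changing [lam]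
    on a given subgroup of the chain ([forced_dense]). Meeting the conditions
    one after the other while freezing longer and longer parts of the chain
    produces a value that satisfies all of them and equals [lam] on any finite
    set given beforehand ([fusion]). This gives density of the set of generic
    values directly, and its comeagerness follows because the complement of
    each condition is nowhere dense.

    For a generic [lam], a back-and-forth argument builds exact isometric
    homomorphisms on larger and larger subgroups of the chain. To bring the
    element [d] of [V] near the range, one takes [x] in [G] that imitates [d]
    up to [e] and corrects the resulting approximate isometry with
    [is_GrN_amalgam]; the homomorphism moves by at most [e]
    ([back_and_forth_step]). With summable errors the homomorphisms converge,
    and the limit has dense image because torsion elements are dense in [V]
    ([back_and_forth]). About [G] this uses that it is countable, torsion, of
    exponent [N], and that every finite subgroup is independent of some element
    of any order that the exponent allows ([Gamma_fresh]). *)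

(** * Finite sets *)

Section finite_sets.

Lemma finite_argmin (R : realType) (T : choiceType) (S : set T) (F : T -> R) :
  finite_set S -> S !=set0 -> exists2 k, S k & forall l, S l -> F k <= F l.
Proof.
move=> fS [k0 Sk0].
have memS x : x \in fset_set S -> S x by rewrite in_fset_set // inE.
have k0S : k0 \in fset_set S by rewrite in_fset_set // inE.
have [k /memS Sk kmin] : exists2 k, k \in fset_set S &
    forall l, l \in fset_set S -> F k <= F l.
  have [[k kS] _ kmin] := @arg_minP _ R _ [` k0S]%fset xpredT
    (fun i : fset_set S => F (val i)) isT.
  by exists k => // l lS; exact: (kmin [` lS]%fset).
by exists k => // l Sl; apply: kmin; rewrite in_fset_set // inE.
Qed.

(** Bounding finitely many values by a real that is itself allowed as a value:
    with [r = 1] the bound is [1], with [r = +oo] it is their maximum with [1]. *)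
Lemma finite_bound (R : realType) (r : \bar R) (T : choiceType) (S : set T)
    (F : T -> R) :
  r = 1%E \/ r = +oo%E -> finite_set S ->
  (forall x, S x -> ((F x)%:E <= r)%E) ->
  exists M : R, [/\ 0 < M, (M%:E <= r)%E & forall x, S x -> F x <= M].
Proof.
move=> [->|->] fS Fr; first by exists 1; split=> // x /Fr; rewrite lee_fin.
have [->|S0] := eqVneq S set0; first by exists 1; split=> //; exact: leey.
have [k Sk kmax] := finite_argmin (fun x => - F x) fS ((set0P _).1 S0).
exists (Num.max 1 (F k)); split=> [||x Sx]; first by rewrite lt_max ltr01.
  exact: leey.
by rewrite le_max -(lerN2 (F k)) kmax // orbT.
Qed.

Lemma near_finite (T : Type) (F : set_system T) (I : choiceType) (A : set I)
    (P : I -> set T) : Filter F -> finite_set A ->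
  (forall i, A i -> F (P i)) -> F [set x | forall i, A i -> P i x].
Proof.
move=> FF fA AP; have : F (\bigcap_(i in [set` fset_set A]) P i).
  by apply: filter_bigI => i; rewrite in_fset_set // inE; exact: AP.
by apply: filterS => x Px i Ai; apply: Px; rewrite /= in_fset_set // inE.
Qed.

End finite_sets.

(** * Finite subgroups *)

Section subgroups.
Implicit Types K : zmodType.

Lemma subgroupN K (A : set K) x : is_subgroup A -> A x -> A (- x).
Proof. by move=> [A0 AB] Ax; rewrite -[- x]add0r; exact: AB. Qed.

Lemma subgroupD K (A : set K) x y : is_subgroup A -> A x -> A y -> A (x + y).
Proof.
by move=> hA Ax Ay; rewrite -[y]opprK; apply: hA.2 => //; exact: subgroupN.
Qed.

(** Natural multiples suffice because only elements of finite order are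
    adjoined. *)
Definition adjoin K (A : set K) (x : K) : set K :=
  [set z | exists a n, A a /\ z = a + x *+ n].

Lemma sub_adjoin K (A : set K) x : A `<=` adjoin A x.
Proof. by move=> a Aa; exists a, 0%N; rewrite mulr0n addr0. Qed.

Lemma mem_adjoin K (A : set K) x : is_subgroup A -> adjoin A x x.
Proof. by move=> [A0 _]; exists 0, 1%N; rewrite add0r mulr1n. Qed.

Lemma mulrn_mod K (x : K) o n : x *+ o = 0 -> x *+ (n %% o) = x *+ n.
Proof.
by move=> xo; rewrite {2}(divn_eq n o) mulrnDr mulnC mulrnA xo mul0rn add0r.
Qed.

Lemma adjoin_subgroup K (A : set K) x o : (0 < o)%N -> x *+ o = 0 ->
  is_subgroup A -> is_subgroup (adjoin A x).
Proof.
move=> o0 xo hA; split; first exact/sub_adjoin/hA.1.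
move=> _ _ [a [m [Aa ->]]] [b [n [Ab ->]]].
(* The multiplier [o.-1] acts as [-1] on [x]. *)
exists (a - b), (m + n * o.-1)%N; split; first exact: hA.2.
have xo1 : x *+ o.-1 = - x.
  by apply/eqP; rewrite -addr_eq0 -mulrSr prednK // xo.
by rewrite mulrnDr mulnC mulrnA xo1 mulNrn opprD addrACA.
Qed.

Lemma adjoin_finite K (A : set K) x o : (0 < o)%N -> x *+ o = 0 ->
  finite_set A -> finite_set (adjoin A x).
Proof.
move=> o0 xo fA.
apply: (@sub_finite_set _ _ ((fun p => p.1 + x *+ p.2) @` (A `*` `I_o))).
  move=> _ [a [n [Aa ->]]]; exists (a, n %% o)%N => /=.
    by split=> //=; rewrite ltn_mod.
  by rewrite mulrn_mod.
by apply: finite_image; apply: finite_setX => //; exact: finite_II.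
Qed.

End subgroups.

(** * Constructions of values *)

Section values.
Variable R : realType.

Section one_value.
Variables (G : zmodType) (p : G -> R) (vp : is_value p).
Implicit Types x y : G.

Lemma is_value0 : p 0 = 0. Proof. exact/(is_value_eq0 vp). Qed.

Lemma is_value_le_sub x y : p x <= p (x - y) + p y.
Proof. by rewrite -{1}(subrK y x); exact: is_valueD. Qed.

Lemma is_valueB x y : p (x - y) <= p x + p y.
Proof. by rewrite -(is_valueN vp y); exact: is_valueD. Qed.

End one_value.

Lemma is_value_intro (G : zmodType) (p : G -> R) :
  (forall x, 0 <= p x) -> p 0 = 0 -> (forall x, p x <= 0 -> x = 0) ->
  (forall x, p (- x) = p x) -> (forall x y, p (x + y) <= p x + p y) ->
  is_value p.
Proof.
move=> p0 pz pinj pN pD; split=> // x; split=> [px|->//].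
by apply: pinj; rewrite px.
Qed.

Lemma valued_is_value (V : valuedZmodType R) : is_value (value : V -> R).
Proof. exact: value_is_value. Qed.

(** The minimum is attained because [S] is finite; adding the minimizers for
    [y] and [z], which [S] allows as a subgroup, gives subadditivity, and
    positivity of both [p] and [s] makes the result definite. *)
Lemma inf_convolution (G K : zmodType) (p : G -> R) (s : K -> R)
    (f : {additive K -> G}) (S : set K) :
  is_value p -> is_value s -> is_subgroup S -> finite_set S ->
  exists m : G -> R, [/\ is_value m,
    forall z k, S k -> m z <= p (z - f k) + s k &
    forall z, exists2 k, S k & m z = p (z - f k) + s k].
Proof.
move=> vp vs hS fS.
have /choice[k kP] z : exists k, S k /\
    forall l, S l -> p (z - f k) + s k <= p (z - f l) + s l.
  have [|k Sk kmin] := finite_argmin (fun k => p (z - f k) + s k) fS.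
    by exists 0; exact: hS.1.
  by exists k.
pose m z := p (z - f (k z)) + s (k z).
have mle z l : S l -> m z <= p (z - f l) + s l by apply: (kP z).2.
exists m; split=> // [|z]; last by exists (k z) => //; exact: (kP z).1.
have m0 z : 0 <= m z by rewrite addr_ge0 ?(is_value_ge0 vp) ?(is_value_ge0 vs).
have mN z : m (- z) <= m z.
  apply: le_trans (mle _ (- k z) (subgroupN hS (kP z).1)) _.
  by rewrite raddfN -opprD (is_valueN vp) (is_valueN vs).
apply: is_value_intro => // [|z mz|z|y z].
- apply/eqP; rewrite eq_le m0 andbT; apply: le_trans (mle _ _ hS.1) _.
  by rewrite raddf0 subrr (is_value0 vp) (is_value0 vs) addr0.
- have : m z == 0 by rewrite eq_le mz m0.
  rewrite /m paddr_eq0 ?is_value_ge0 // => /andP[/eqP pz /eqP sz].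
  move: pz; have -> : k z = 0 by exact/(is_value_eq0 vs).
  by rewrite raddf0 subr0 => /(is_value_eq0 vp).
- by apply/eqP; rewrite eq_le mN -{1}(opprK z) mN.
- apply: le_trans (mle _ (k y + k z) _) _.
    exact: subgroupD hS (kP y).1 (kP z).1.
  rewrite raddfD opprD (addrACA y) /m [leRHS]addrACA.
  by rewrite lerD ?(is_valueD vp) ?(is_valueD vs).
Qed.

Lemma is_value_discrete (G : zmodType) (e : R) : 0 < e ->
  is_value (fun x : G => if x == 0 then 0 else e).
Proof.
move=> e0; apply: is_value_intro => [x||x|x|x y].
- by case: ifP => // _; exact: ltW.
- by rewrite eqxx.
- by case: eqP => // _; rewrite leNgt e0.
- by rewrite oppr_eq0.
- have [->|x0] := eqVneq x 0; first by rewrite !add0r.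
  have [->|y0] := eqVneq y 0; first by rewrite !addr0 (negPf x0).
  by case: ifP => _; rewrite ?addr_ge0 ?lerDl // ltW.
Qed.

Lemma is_value_prod (G H : zmodType) (p : G -> R) (q : H -> R) :
  is_value p -> is_value q -> is_value (fun z : G * H => p z.1 + q z.2).
Proof.
move=> vp vq; apply: is_value_intro => [x||[x y] /= h|x|x y].
- by rewrite addr_ge0 ?(is_value_ge0 vp) ?(is_value_ge0 vq).
- by rewrite /= (is_value0 vp) (is_value0 vq) addr0.
- have : p x + q y == 0 by rewrite eq_le h addr_ge0 ?is_value_ge0.
  rewrite paddr_eq0 ?is_value_ge0 // => /andP[/eqP + /eqP].
  by move=> /(is_value_eq0 vp) -> /(is_value_eq0 vq) ->.
- by rewrite /= (is_valueN vp) (is_valueN vq).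
- by rewrite /= addrACA lerD ?(is_valueD vp) ?(is_valueD vq).
Qed.

Lemma is_value_min (G : zmodType) (p : G -> R) (M : R) : 0 < M ->
  is_value p -> is_value (fun x => Num.min M (p x)).
Proof.
move=> M0 vp; apply: is_value_intro => [x||x|x|x y].
- by rewrite le_min ltW // is_value_ge0.
- by rewrite (is_value0 vp) min_r // ltW.
- rewrite ge_min leNgt M0 /= => px; apply/(is_value_eq0 vp)/eqP.
  by rewrite eq_le px is_value_ge0.
- by rewrite (is_valueN vp).
- have px := is_value_ge0 vp x; have py := is_value_ge0 vp y.
  have := is_valueD vp x y.
  by rewrite !minElt; do 3 case: ifP => ?; lra.
Qed.

(** The triangle inequality survives: when [x] or [y] lies outside [A], the
    right-hand side is at least [M]; otherwise [x + y] lies in [A] as well. *)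
Lemma is_value_extend (G : zmodType) (p : G -> R) (A : set G) (M : R) : 0 < M ->
  is_value p -> is_subgroup A -> (forall x, A x -> p x <= M) ->
  is_value (fun x => if x \in A then p x else M).
Proof.
move=> M0 vp hA pM; apply: is_value_intro => [x||x|x|x y].
- by case: ifP => _; [exact: is_value_ge0|exact: ltW].
- by rewrite mem_set ?(is_value0 vp) //; exact: hA.1.
- case: ifP => _ h; last by move: M0; rewrite ltNge h.
  by apply/(is_value_eq0 vp)/eqP; rewrite eq_le h is_value_ge0.
- suff -> : (- x \in A) = (x \in A) by rewrite (is_valueN vp).
  apply/idP/idP; rewrite !inE => Ax; last exact: subgroupN.
  by rewrite -[x]opprK; exact: subgroupN.
- have px := is_value_ge0 vp x; have py := is_value_ge0 vp y.
  have pxy := is_valueD vp x y.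
  case: ifP => xyA; case: ifP => xA; case: ifP => yA //; rewrite ?inE in xyA xA yA.
  + by rewrite (le_trans (pM _ xyA)) // lerDr.
  + by rewrite (le_trans (pM _ xyA)) // lerDl.
  + by rewrite (le_trans (pM _ xyA)) // lerDl ltW.
  + by move/negP : xyA; case; rewrite inE; exact: subgroupD.
  + by rewrite lerDr.
  + by rewrite lerDl.
  + by rewrite lerDl ltW.
Qed.

End values.

(** * Extension properties of the universal group *)

Section subgroup_type.
Variables (K : zmodType) (H : set K) (hH : is_subgroup H).

(** The proof that [H] is a subgroup is an argument, so that the group structure
    below can be found by unification. *)
Definition subgroup_pred of is_subgroup H : {pred K} := fun x => `[< H x >].

Fact subgroup_pred_zmod_closed : zmod_closed (subgroup_pred hH).
Proof.
split=> [|x y /asboolP Hx /asboolP Hy]; apply/asboolP; first exact: hH.1.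
exact: hH.2.
Qed.

HB.instance Definition _ := GRing.isZmodClosed.Build K (subgroup_pred hH)
  subgroup_pred_zmod_closed.

Record subgroup_type := SubgroupType {
  subgroup_val :> K;
  _ : subgroup_val \in subgroup_pred hH
}.

HB.instance Definition _ := [isSub for subgroup_val].
HB.instance Definition _ := [Choice of subgroup_type by <:].
HB.instance Definition _ := [SubChoice_isSubZmodule of subgroup_type by <:].

Lemma subgroup_typeP (x : subgroup_type) : H (val x).
Proof. exact/asboolP/(valP x). Qed.

Lemma subgroup_type_surj x : H x -> exists y : subgroup_type, val y = x.
Proof. by move=> /asboolP Hx; exists (SubgroupType Hx). Qed.

Lemma subgroup_type_finite : finite_set H -> finite_set [set: subgroup_type].
Proof.
move=> fH; have valI : {in val @^-1` H &, injective (val : subgroup_type -> K)}.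
  by move=> x y _ _; exact: val_inj.
by apply: sub_finite_set (finite_preimage valI fH) => x _; exact: subgroup_typeP.
Qed.

End subgroup_type.

Section partial_homs.
Variable R : realType.

Definition additive_on (K L : zmodType) (A : set K) (f : K -> L) :=
  forall x y, A x -> A y -> f (x + y) = f x + f y.

Definition isometric_on (K : zmodType) (V : valuedZmodType R) (p : K -> R)
  (A : set K) (f : K -> V) := forall x, A x -> value (f x) = p x.

Lemma additive_on0 (K L : zmodType) (A : set K) (f : K -> L) :
  is_subgroup A -> additive_on A f -> f 0 = 0.
Proof.
move=> hA fD; have := fD _ _ hA.1 hA.1.
by rewrite addr0 -{1}[f 0]addr0 => /addrI.
Qed.

Lemma additive_onN (K L : zmodType) (A : set K) (f : K -> L) x :
  is_subgroup A -> additive_on A f -> A x -> f (- x) = - f x.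
Proof.
move=> hA fD Ax; apply/eqP; rewrite -addr_eq0 -fD //; last exact: subgroupN.
by rewrite addNr (additive_on0 hA fD).
Qed.

Lemma additive_onB (K L : zmodType) (A : set K) (f : K -> L) x y :
  is_subgroup A -> additive_on A f -> A x -> A y -> f (x - y) = f x - f y.
Proof.
move=> hA fD Ax Ay; rewrite fD //; last exact: subgroupN.
by rewrite (additive_onN hA fD).
Qed.

Lemma additive_on_image (K L : zmodType) (A : set K) (f : K -> L) :
  is_subgroup A -> additive_on A f -> is_subgroup (f @` A).
Proof.
move=> hA fD; split; first by exists 0; [exact: hA.1|exact: additive_on0 fD].
move=> _ _ [x Ax <-] [y Ay <-]; exists (x - y); first exact: hA.2.
exact: additive_onB fD Ax Ay.
Qed.

(** A value on a finite group is bounded, so dividing by [n] makes it vanish in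
    the limit. *)
Lemma finite_in_class (r : \bar R) (N : nat) (V : valuedZmodType R) :
  finite_set [set: V] -> (forall x : V, ((value x : R)%:E <= r)%E) ->
  (forall x : V, x *+ N = 0) -> in_class r N V.
Proof.
move=> fV Vr VN; split=> // [|x].
  exists [set: metric_of V]; first exact: finite_set_countable.
  by move=> O [x Ox] _; exists x.
have [M [_ _ Mle]] := finite_bound (F := value) (or_intror erefl) fV
  (fun x _ => leey _).
have M0 : (M * (harmonic n : R)) @[n --> \oo] --> 0.
  by rewrite -[0](mulr0 M); apply: cvgM; [exact: cvg_cst|exact: cvg_harmonic].
rewrite -cvg_shiftS; apply: squeeze_cvgr (cvg_cst 0) M0.
apply: nearW => n /=; rewrite divr_ge0 ?ler0n ?value_ge0 //=.
by rewrite ler_pM2r ?invr_gt0 // Mle.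
Qed.

(** Finite isometries into [V] extend: universality provides some copy of the
    larger group in [V], and homogeneity moves it onto the given one. *)
Lemma is_GrN_extend (r : \bar R) (N : nat) (V : valuedZmodType R)
    (K : zmodType) (m : K -> R) (H A : set K) (phi : K -> V) :
  is_GrN r N V -> is_value m -> is_subgroup H -> finite_set H ->
  (forall x, H x -> ((m x)%:E <= r)%E) -> (forall x, H x -> x *+ N = 0) ->
  is_subgroup A -> A `<=` H -> additive_on A phi -> isometric_on m A phi ->
  exists psi : K -> V, [/\ additive_on H psi, isometric_on m H psi &
    forall x, A x -> psi x = phi x].
Proof.
move=> GV vm hH fH mr HN hA AH phiD phim.
pose HT := subgroup_type hH.
have val0 : val (0 : HT) = 0 by [].
have valN (x : HT) : val (- x) = - val x by [].
have valD (x y : HT) : val (x + y) = val x + val y by [].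
have valMn (x : HT) n : val (x *+ n) = val x *+ n.
  by elim: n => // n IH; rewrite !mulrS valD IH.
have vHT : @is_value R HT (m \o val).
  apply: is_value_intro => [x||x|x|x y] /=.
  - exact: is_value_ge0.
  - exact: (is_value0 vm).
  - move=> mx; apply/val_inj/(is_value_eq0 vm)/eqP.
    by rewrite eq_le mx is_value_ge0.
  - exact: (is_valueN vm).
  - exact: (is_valueD vm).
have [|e einj eiso] := is_GrN_universal GV (H := valued_by vHT)
    (subgroup_type_finite hH fH).
  apply: (@finite_in_class r N (valued_by vHT)) => [|x|x].
    exact: subgroup_type_finite hH fH.
    exact: mr (subgroup_typeP x).
  apply: val_inj; exact: etrans (valMn x N) (HN _ (subgroup_typeP x)).
(* [s] turns elements of [H] into elements of the type of [H], and [j] is the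
   copy of [H] in [V] given by universality. *)
have /choice[s sP] (x : K) : exists y : HT, H x -> val y = x.
  have [/subgroup_type_surj[y yx]|nHx] := pselect (H x); first by exists y.
  by exists 0.
pose j x : V := e (s x).
have jD : additive_on H j.
  move=> x y Hx Hy; rewrite /j; have -> : s (x + y) = s x + s y.
    by apply: val_inj; rewrite valD !sP //; exact: subgroupD.
  exact: raddfD.
have jm : isometric_on m H j.
  by move=> x Hx; exact: etrans (eiso _) (congr1 m (sP x Hx)).
have jinj x y : H x -> H y -> j x = j y -> x = y.
  by move=> Hx Hy /einj sxy; rewrite -(sP x) // sxy sP.
have /choice[f fP] (v : V) : exists w, forall x, A x -> j x = v -> w = phi x.
  have [[x Ax jx]|nv] := pselect (exists2 x, A x & j x = v).
    exists (phi x) => y Ay jy; congr phi; apply: jinj; [exact: AH..|].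
    by rewrite jx jy.
  by exists 0 => x Ax jx; case: nv; exists x.
have fj x : A x -> f (j x) = phi x by move=> Ax; exact: fP.
have jDA : additive_on A j by move=> x y Ax Ay; apply: jD; exact: AH.
have [||||||x Ax|g [giso _ gf]] := is_GrN_homogeneous GV (A := j @` A)
    (B := phi @` A) (f := f).
- exact: additive_on_image.
- by apply: finite_image; exact: sub_finite_set fH.
- exact: additive_on_image.
- by apply: finite_image; exact: sub_finite_set fH.
- by move=> _ [x Ax <-]; exists x => //; rewrite fj.
- move=> _ _ [x Ax <-] [y Ay <-].
  by rewrite -jDA // !fj //; [exact: phiD|exact: subgroupD].
- by case: Ax => y Ay <-; rewrite fj // phim // jm //; exact: AH.
exists (g \o j); split=> [x y Hx Hy|x Hx|x Ax] /=.
- by rewrite jD // raddfD.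
- by rewrite giso jm.
- by rewrite gf ?fj //; exists x.
Qed.

(** Correcting an approximate isometry [S] into an exact one. On [G * V] take
    the value [m] that is the inf-convolution of [p z.1 + value z.2] with the
    discrete value [e] along the elements [(x, - v)] for [(x, v)] in [S]. The
    bound on [|p x - value v|] makes [m] restrict to [p] on [G] and to the value
    of [V] on [V], while [m (x, - v) <= e]. Let [D] be the projection of [S] to
    [V]. Extending the inclusion of [D] from [0 * D] to [C * D] puts a copy of
    [C] in [V], at distance at most [e] from where [S] wants it. *)
Lemma is_GrN_amalgam (r : \bar R) (N : nat) (V : valuedZmodType R)
    (G : zmodType) (p : G -> R) (S : set (G * V)) (C : set G) (e : R) :
  r = 1%E \/ r = +oo%E -> is_GrN r N V -> is_value p ->
  (forall x, ((p x)%:E <= r)%E) -> (forall x : G, x *+ N = 0) ->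
  is_subgroup C -> finite_set C -> is_subgroup S -> finite_set S ->
  (forall x v, S (x, v) -> C x) -> 0 < e ->
  (forall x v, S (x, v) -> `|p x - value v| <= e) ->
  exists psi : G -> V, [/\ additive_on C psi, isometric_on p C psi &
    forall x v, S (x, v) -> value (psi x - v) <= e].
Proof.
move=> hr GV vp pr GN hC fC hS fS SC e0 Se.
have VN := in_class_exponent (is_GrN_class GV).
have Vr := in_class_bound (is_GrN_class GV).
have vV := valued_is_value V.
pose f (z : G * V) := (z.1, - z.2).
have fB : additive f by move=> [x v] [y w]; rewrite /f /= opprD.
pose fA : {additive G * V -> G * V} := HB.pack f (GRing.isZmodMorphism.Build _ _ f fB).
have [m [vm mle mE]] := inf_convolution fA (is_value_prod vp vV)
  (is_value_discrete (G * V)%type e0) hS fS.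
pose D : set V := snd @` S.
have hD : is_subgroup D by apply: additive_on_image => //; move=> [x v] [y w].
have fD : finite_set D by exact: finite_image.
have m_l x : m (x, 0) = p x.
  apply/eqP; rewrite eq_le; apply/andP; split.
    apply: le_trans (mle _ 0 hS.1) _.
    by rewrite eqxx addr0 raddf0 subr0 /= value0 addr0.
  have [[b h] /= Sbh ->] := mE (x, 0); rewrite /= sub0r opprK.
  have := Se _ _ Sbh; rewrite ler_norml => /andP[_].
  have := is_value_le_sub vp x b; have := value_ge0 h.
  case: eqP => [[-> ->]|_]; first by rewrite subr0 value0; lra.
  lra.
have m_r v : m (0, v) = value v.
  apply/eqP; rewrite eq_le; apply/andP; split.
    apply: le_trans (mle _ 0 hS.1) _.
    by rewrite eqxx addr0 raddf0 subr0 /= (is_value0 vp) add0r.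
  have [[b h] /= Sbh ->] := mE (0, v); rewrite /= sub0r opprK (is_valueN vp).
  have := Se _ _ Sbh; rewrite ler_norml => /andP[+ _].
  have := is_valueB vV (v + h) h; rewrite addrK; have := is_value_ge0 vp b.
  case: eqP => [[-> ->]|_]; first by rewrite addr0 value0; lra.
  lra.
have m_S x v : S (x, v) -> m (x, - v) <= e.
  move=> Sxv; apply: le_trans (mle _ _ Sxv) _.
  rewrite subrr /= (is_value0 vp) value0 !add0r.
  by case: ifP => // _; exact: ltW.
(* Truncation at [M] respects the bound [r] and is invisible on [C] and [D]. *)
have [M1 [M10 M1r M1C]] := finite_bound hr fC (fun x _ => pr x).
have [M2 [M20 M2r M2D]] := finite_bound hr fD (fun x _ => Vr x).
pose M := Num.max M1 M2.
have M0 : 0 < M by rewrite lt_max M10.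
have Mr : (M%:E <= r)%E by rewrite /M maxEle; case: ifP.
have hCD : is_subgroup (C `*` D).
  split; first by split; [exact: hC.1|exact: hD.1].
  by move=> x y [Cx Dx] [Cy Dy]; split; [exact: hC.2|exact: hD.2].
have h0D : is_subgroup ([set 0 : G] `*` D).
  split; first by split=> //; exact: hD.1.
  by move=> [_ v] [_ w] [/= -> Dv] [/= -> Dw]; split; rewrite /= ?subrr //; exact: hD.2.
have [|[x v] _|[x v] _||[x v] [/= -> Dv]|[x v] [y w] _ _|[x v] [/= -> Dv]|
    Psi [PsiD Psim PsiE]] :=
  is_GrN_extend (phi := snd) (A := [set 0] `*` D) GV (is_value_min M0 vm) hCD.
- exact: finite_setX.
- by apply: le_trans Mr; rewrite lee_fin ge_min lexx.
- by rewrite pairMnE /= GN VN.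
- exact: h0D.
- by split=> //; exact: hC.1.
- by [].
- by rewrite /= m_r min_r // le_max M2D // orbT.
exists (fun x => Psi (x, 0)); split=> [x y Cx Cy|x Cx|x v Sxv].
- rewrite -PsiD; [|by split=> //=; exact: hD.1..].
  by congr Psi; rewrite /GRing.add /= /add_pair /= addr0.
- rewrite Psim; last by split=> //; exact: hD.1.
  by rewrite m_l min_r // le_max M1C.
- have Cx := SC _ _ Sxv; have Dv : D (- v) by apply: subgroupN => //; exists (x, v).
  have <- : Psi (0, - v) = - v by rewrite PsiE.
  rewrite -PsiD; last 2 first.
  + by split=> //; exact: hD.1.
  + by split=> //; exact: hC.1.
  have -> : (x, 0) + (0, - v) = (x, - v).
    by rewrite /GRing.add /= /add_pair /= addr0 add0r.
  rewrite Psim //; apply: le_trans (m_S _ _ Sxv); by rewrite ge_min lexx orbT.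
Qed.

End partial_homs.

(** * Realizing a prescribed extension *)

Section realization.
Variables (R : realType) (G : zmodType) (V : valuedZmodType R).

Lemma graph_subgroup (A : set G) (phi : G -> V) :
  is_subgroup A -> additive_on A phi ->
  is_subgroup ((fun a => (a, phi a)) @` A).
Proof.
move=> hA phiD; apply: additive_on_image => // x y Ax Ay.
by rewrite phiD.
Qed.

(** The new value is the inf-convolution of [w], which is [lam] on [E] and a
    large constant elsewhere, with the value of [V] increased by [e] off zero,
    along the subgroup [S] generated by the graph of [phi] and by [(x, d)].
    Independence of [x] from [E] means that [S] meets [E] only in the graph of
    [phi], where [lam] and the value of [V] differ by at most [e]; that
    is why the extra [e] suffices to keep the value of [lam] on [E]. *)
Lemma realization (r : \bar R) (lam : G -> R) (A E : set G) (phi : G -> V)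
    (d : V) (x : G) (o : nat) (e : R) :
  r = 1%E \/ r = +oo%E -> is_value lam -> (forall z, ((lam z)%:E <= r)%E) ->
  (forall v : V, ((value v : R)%:E <= r)%E) ->
  is_subgroup A -> is_subgroup E -> finite_set E -> A `<=` E ->
  additive_on A phi -> 0 < e ->
  (forall a, A a -> `|lam a - value (phi a)| <= e) ->
  (0 < o)%N -> d *+ o = 0 -> x *+ o = 0 ->
  (forall k, E (x *+ k) -> (o %| k)%N) ->
  exists lam' : G -> R, [/\ is_value lam', forall z, ((lam' z)%:E <= r)%E,
    forall z, E z -> lam' z = lam z &
    forall a k, A a ->
      `|lam' (a + x *+ k) - value (phi a + d *+ k)| <= e].
Proof.
move=> hr vl lr Vr hA hE fE AE phiD e0 lphi o0 od xo xE.
have vV := valued_is_value V.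
pose S : set (G * V) := adjoin ((fun a => (a, phi a)) @` A) (x, d).
have xdo : (x, d) *+ o = 0 by rewrite pairMnE /= xo od.
have hS : is_subgroup S by apply: adjoin_subgroup o0 xdo _; exact: graph_subgroup.
have fS : finite_set S.
  by apply: adjoin_finite o0 xdo _; apply: finite_image; exact: sub_finite_set fE.
(* The only elements of [S] over [E] are those of the graph of [phi]. *)
have SE b h : S (b, h) -> E b -> A b /\ h = phi b.
  move=> [_ [k [[a Aa <-]]]]; rewrite pairMnE => -[-> ->] Eb.
  have : E (x *+ k).
    by rewrite -(addrK a (x *+ k)) (addrC _ a); apply: hE.2 => //; exact: AE.
  by move=> /xE /dvdnP[q ->]; rewrite mulnC !mulrnA xo od !mul0rn !addr0.
have [M1 [M10 M1r M1E]] := finite_bound hr fE (fun x _ => lr x).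
have [M2 [M20 M2r M2S]] := finite_bound (F := value \o snd) hr fS (fun x _ => Vr _).
pose M := Num.max M1 M2.
have M0 : 0 < M by rewrite lt_max M10.
have Mr : (M%:E <= r)%E by rewrite /M maxEle; case: ifP.
have ME z : E z -> lam z <= M by move=> Ez; rewrite le_max M1E.
have MS b h : S (b, h) -> value h <= M.
  by move=> Sbh; rewrite le_max (M2S _ Sbh) orbT.
have vw := is_value_extend M0 vl hE ME; set w := (fun z => _) in vw.
pose s (z : G * V) : R := value z.2 + (if z == 0 then 0 else e).
have vs : is_value s.
  have ve := is_value_discrete (G * V)%type e0.
  apply: is_value_intro => [z||z|z|y z].
  - by rewrite addr_ge0 ?value_ge0 ?(is_value_ge0 ve).
  - by rewrite /s eqxx /= value0 addr0.
  - rewrite /s; case: eqP => // _; rewrite leNgt (lt_le_trans e0) //.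
    by rewrite lerDr value_ge0.
  - by rewrite /s (is_valueN ve) /= valueN.
  - by rewrite /s addrACA lerD ?valueD ?(is_valueD ve).
have [m [vm mle mE]] := inf_convolution fst vw vs hS fS.
have m0 z : m z <= w z.
  by apply: le_trans (mle _ _ hS.1) _; rewrite (is_value0 vs) subr0 addr0.
have s_ge z : value z.2 <= s z.
  by rewrite /s lerDl; case: ifP => // _; exact: ltW.
exists m; split=> // [z|z Ez|a k Aa].
- have := m0 z; rewrite /w; case: ifP => _ mz; last by apply: le_trans Mr.
  by apply: le_trans (lr z).
(* No representation of a point of [E] improves on [lam]. *)
- apply/eqP; rewrite eq_le; apply/andP; split.
    by apply: le_trans (m0 _) _; rewrite /w mem_set.
  have [[b h] Sbh ->] := mE z; rewrite /= /w; case: ifP => zbE; last first.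
    by rewrite (le_trans (ME _ Ez)) // lerDl (is_value_ge0 vs).
  rewrite inE in zbE.
  have Eb : E b by rewrite -(subKr z b); exact: hE.2.
  have [Ab ->] := SE _ _ Sbh Eb; rewrite /s /=.
  have := lphi _ Ab; rewrite ler_norml => /andP[_]; have := is_value_le_sub vl z b.
  have := value_ge0 (phi b).
  case: eqP => [[-> ->]|_]; first by rewrite value0 subr0; lra.
  lra.
- have Sb : S (a + x *+ k, phi a + d *+ k).
    by exists (a, phi a), k; split; [exists a|rewrite pairMnE].
  move: Sb; move: (a + x *+ k) (phi a + d *+ k) => b h Sbh.
  have m_le : m b <= value h + e.
    apply: le_trans (mle _ _ Sbh) _.
    rewrite subrr (is_value0 vw) add0r /s; case: ifP => _ //=.
    by rewrite lerD2l ltW.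
  (* For the lower bound, a minimizer [(b', h')] leaves either a remainder in
     the graph of [phi], or the constant [M], which exceeds [value h]. *)
  suff : value h - e <= m b by move=> ?; rewrite ler_norml; apply/andP; split; lra.
  have [[b' h'] Sbh' ->] := mE b; have /= := s_ge (b', h').
  rewrite /w; case: ifP => bE /= sh'.
    rewrite inE in bE; have [Ab bh] : A (b - b') /\ h - h' = phi (b - b').
      by apply: SE => //; exact: hS.2 Sbh Sbh'.
    have := lphi _ Ab; rewrite -bh ler_norml => /andP[+ _].
    have := is_value_le_sub vV h h'; lra.
  have := MS _ _ Sbh; have := value_ge0 h'; lra.
Qed.

End realization.

(** * The space of values *)

Section pointwise_topology.
Variables (R : realType) (r : \bar R) (G : zmodType).

Definition value_fun (lam : values r G) : G -> R := set_val lam.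

Lemma value_fun_is_value lam : is_value (value_fun lam).
Proof. exact: values_is_value. Qed.

Lemma value_fun_bound lam x : ((value_fun lam x)%:E <= r)%E.
Proof. by have [_] := set_valP lam; exact. Qed.

Lemma value_fun_surj (p : G -> R) : is_value p -> (forall x, ((p x)%:E <= r)%E) ->
  exists lam, value_fun lam = p.
Proof.
move=> vp pr; have h : (p : {ptws G -> R}) \in values r G by rewrite inE; split.
by exists (SigSub h : values r G).
Qed.

Lemma value_fun_continuous x : continuous (fun lam : values r G => value_fun lam x).
Proof.
move=> lam.
have ev : (set_val : values r G -> {ptws G -> R}) @ lam --> set_val lam.
  exact: initial_continuous.
exact: continuous_comp ev (@proj_continuous G (fun=> R) x _).
Qed.

(** Pointwise eventually constant sequences converge. Applied to values that
    agree with [lam] on longer and longer parts of [G], this finds one of them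
    in any given neighborhood of [lam]. *)
Lemma pointwise_eventually (lam : values r G) (mu : nat -> values r G)
    (W : set (values r G)) : nbhs lam W ->
  (forall x, exists n, forall k, (n <= k)%N -> value_fun (mu k) x = value_fun lam x) ->
  exists k, W (mu k).
Proof.
move=> [_ /= [[Q oQ <-] Qlam QW]] muE.
have cv : (fun k => set_val (mu k) : {ptws G -> R}) @ \oo -->
    (set_val lam : {ptws G -> R}).
  apply/cvg_sup => x; apply/cvg_image.
    by rewrite eqEsubset; split=> // t _; exists (cst t).
  move=> B /= Bx; have [n nE] := muE x.
  exists ((fun f : {ptws G -> R} => f x) @^-1` B).
    exists n => // k /= nk; rewrite /preimage /=.
    have -> : set_val (mu k) x = value_fun lam x by exact: nE.
    exact: nbhs_singleton Bx.
  rewrite eqEsubset; split=> [_ [f Bf <-] //|t Bt]; by exists (cst t).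
have /cv [k _ Qk] : nbhs (set_val lam : {ptws G -> R}) Q by exact: open_nbhs_nbhs.
by exists k; apply: QW; exact: Qk (leqnn k).
Qed.

End pointwise_topology.

(** * Exhaustion by finite subgroups and fusion *)

Section chain.
Variables (G : zmodType) (g : nat -> G).
Hypothesis g_surj : forall x, exists n, g n = x.
Hypothesis G_torsion : forall x : G, exists2 o, (0 < o)%N & x *+ o = 0.

Fixpoint chain n : set G :=
  if n is n'.+1 then adjoin (chain n') (g n') else [set 0].

Lemma chain_subgroup n : is_subgroup (chain n).
Proof.
elim: n => [|n IH] /=; first by split=> // _ _ -> ->; rewrite subrr.
by have [q q0 gq] := G_torsion (g n); exact: adjoin_subgroup q0 gq IH.
Qed.

Lemma chain_finite n : finite_set (chain n).
Proof.
elim: n => [|n IH] /=; first exact: finite_set1.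
by have [q q0 gq] := G_torsion (g n); exact: adjoin_finite q0 gq IH.
Qed.

Lemma chain_mono m n : (m <= n)%N -> chain m `<=` chain n.
Proof.
move=> /subnK <-; elim: (n - m)%N => // k IH x /IH.
exact: sub_adjoin.
Qed.

Lemma chain_cover x : exists n, chain n x.
Proof.
by have [n <-] := g_surj x; exists n.+1; exact: mem_adjoin (chain_subgroup n).
Qed.

Lemma chain_absorb (F : set G) : finite_set F -> exists n, F `<=` chain n.
Proof.
move=> fF; have /choice[h hP] := chain_cover.
pose k := \max_(x <- fset_set F) h x.
exists k => x Fx; apply: (chain_mono _ (hP x)).
by rewrite /k; apply: leq_bigmax_seq => //; rewrite in_fset_set // inE.
Qed.

(** If each [P j] can be secured by fixing the value on some term of the chain,
    without changing it on a given term, then all of them hold for the value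
    obtained by securing [P 0], [P 1], and so on, each time fixing a longer
    initial part of the chain. Every requirement on the limit concerns finitely
    many points, where it coincides with a stage of the construction. *)
Lemma fusion (R : realType) (r : \bar R) (P : nat -> set (G -> R))
    (lam : G -> R) (m : nat) :
  (forall j mu n, is_value mu -> (forall x, ((mu x)%:E <= r)%E) ->
    exists mu' n', [/\ is_value mu', forall x, ((mu' x)%:E <= r)%E,
      forall x, chain n x -> mu' x = mu x &
      forall mu'', (forall x, chain n' x -> mu'' x = mu' x) -> P j mu'']) ->
  is_value lam -> (forall x, ((lam x)%:E <= r)%E) ->
  exists lam', [/\ is_value lam', forall x, ((lam' x)%:E <= r)%E,
    forall x, chain m x -> lam' x = lam x & forall j, P j lam'].
Proof.
move=> step vl lr.
pose good (s : (G -> R) * nat) := is_value s.1 /\ forall x, ((s.1 x)%:E <= r)%E.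
have stp (t : nat * ((G -> R) * nat)) : exists s : (G -> R) * nat, good t.2 ->
    [/\ good s, (t.2.2 < s.2)%N, forall x, chain t.2.2 x -> s.1 x = t.2.1 x &
      forall mu'', (forall x, chain s.2 x -> mu'' x = s.1 x) -> P t.1 mu''].
  have [[vt tr]|nt] := pselect (good t.2); last by exists t.2.
  have [mu' [n' [v' r' E' P']]] := step t.1 _ t.2.2 vt tr.
  exists (mu', maxn t.2.2.+1 n') => _; split=> //=; first by rewrite leq_maxl.
  move=> mu'' E''; apply: P' => x n'x; apply: E''.
  exact: chain_mono (leq_maxr _ _) _ n'x.
have [F FP] := choice stp.
(* Stage [j] is a value with the index up to which it is final. *)
pose s := fix s j := if j is j'.+1 then F (j', s j') else (lam, m).
have sgood j : good (s j).
  by elim: j => [//|j IH]; have [] := FP (j, s j) IH.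
have sP j : [/\ ((s j).2 < (s j.+1).2)%N,
    forall x, chain (s j).2 x -> (s j.+1).1 x = (s j).1 x &
    forall mu'', (forall x, chain (s j.+1).2 x -> mu'' x = (s j.+1).1 x) -> P j mu''].
  by have [] := FP (j, s j) (sgood j).
have s_ge j : (j <= (s j).2)%N.
  elim: j => // j IH; apply: leq_ltn_trans IH _; by have [] := sP j.
have s_mono i j : (i <= j)%N -> ((s i).2 <= (s j).2)%N /\
    forall x, chain (s i).2 x -> (s j).1 x = (s i).1 x.
  move=> /subnK <-; elim: (j - i)%N => // k [IH1 IH2].
  have [lt E _] := sP (k + i)%N; split=> [|x ix].
    exact: leq_trans IH1 (ltnW lt).
  rewrite addSn E; first exact: IH2.
  exact: chain_mono IH1 _ ix.
have /choice[h hP] := chain_cover.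
pose L x := (s (h x)).1 x.
have LE j x : chain (s j).2 x -> L x = (s j).1 x.
  move=> jx; have hx : chain (s (h x)).2 x by apply: chain_mono (hP x).
  have [/s_mono[_ E]|/ltnW/s_mono[_ E]] := leqP j (h x).
    by rewrite /L E.
  by rewrite /L E.
have Lat (A : set G) : finite_set A -> exists j, forall x, A x -> L x = (s j).1 x.
  move=> /chain_absorb[n An]; exists n => x /An nx; apply: LE.
  exact: chain_mono nx.
exists L; split=> [|x|x mx|j].
- apply: is_value_intro => [x||x Lx|x|x y].
  + exact: is_value_ge0 (sgood _).1 _.
  + have [j ->//] := Lat [set 0] (finite_set1 _); exact: is_value0 (sgood j).1.
  + move: Lx; rewrite /L => sx; apply/(is_value_eq0 (sgood (h x)).1)/eqP.
    by rewrite eq_le sx is_value_ge0 //; exact: (sgood _).1.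
  + have [j jE] := Lat [set x; - x] (finite_set2 _ _).
    by rewrite !jE; [exact: is_valueN (sgood j).1 _|left|right].
  + have [j jE] := Lat [set x; y; x + y] (finite_set3 _ _ _).
    rewrite !jE; [exact: is_valueD (sgood j).1 _ _|by left; right|..].
      by left; left.
    by right.
- exact: (sgood _).2.
- exact: (LE 0%N).
- by have [_ _] := sP j; apply=> x; exact: LE.
Qed.

End chain.

(** * Generic values *)

Section generic.
Variables (R : realType) (r : \bar R) (N : nat) (V : valuedZmodType R).
Variables (G : zmodType) (g : nat -> G).
Hypothesis hr : r = 1%E \/ r = +oo%E.
Hypothesis GV : is_GrN r N V.
Hypothesis g_surj : forall x, exists n, g n = x.
Hypothesis G_torsion : forall x : G, exists2 o, (0 < o)%N & x *+ o = 0.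
Hypothesis G_fresh : forall (A : set G) o, is_subgroup A -> finite_set A ->
  (0 < o)%N -> (o %| N)%N ->
  exists x, x *+ o = 0 /\ forall k, A (x *+ k) -> (o %| k)%N.

(** A table [c] prescribes, for [a] in the [n]-th subgroup and [k < o], the
    value of [a + x *+ k] for an element [x] yet to be found. It is admissible
    when it approximates a table that occurs in [V]. So the conditions speak
    about [V], and yet the countably many tables given by [decode] suffice. *)
Definition admissible (n o : nat) (c : G -> nat -> R) (e : R) :=
  exists (phi : G -> V) (d : V),
    [/\ additive_on (chain g n) phi, d *+ o = 0, (0 < o)%N, (o %| N)%N &
      forall a k, chain g n a -> (k < o)%N ->
        `|value (phi a + d *+ k) - c a k| <= e].

(** The constant 4 leaves room for the construction below: [lam] is off from
    [V] by [2 * e] on the [n]-th subgroup, [realization] reproduces [V] up to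
    the same error, and [V] is off from the table by [e], which makes
    [3 * e < 4 * e]. *)
Definition realizes (lam : G -> R) (n o : nat) (c : G -> nat -> R) (e : R) :=
  exists2 x : G, x *+ o = 0 & forall a k, chain g n a -> (k < o)%N ->
    `|lam (a + x *+ k) - c a k| < 4 * e.

Definition fits (lam : G -> R) (n : nat) (c : G -> nat -> R) (e : R) :=
  forall a, chain g n a -> `|lam a - c a 0%N| <= e.

Definition forced n o c e : set (G -> R) :=
  [set lam | admissible n o c e -> fits lam n c e -> realizes lam n o c e].

Let cS := chain_subgroup g G_torsion.
Let cF := chain_finite g G_torsion.

(** If the premises hold, [realization] over the larger of the two subgroups
    meets the condition, and it stays met as long as the value is kept on the
    finitely many points [a + x *+ k]. If a premise fails, it keeps failing as
    long as [lam] is kept on the [n]-th subgroup. *)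
Lemma forced_dense n o c e lam m : 0 < e ->
  is_value lam -> (forall x, ((lam x)%:E <= r)%E) ->
  exists lam' m', [/\ is_value lam', forall x, ((lam' x)%:E <= r)%E,
    forall x, chain g m x -> lam' x = lam x &
    forall mu, (forall x, chain g m' x -> mu x = lam' x) -> forced n o c e mu].
Proof.
move=> e0 vl lr.
have [[adm fit]|nc] := pselect (admissible n o c e /\ fits lam n c e); last first.
  exists lam, n; split=> // mu mulam adm fit; case: nc; split=> // a na.
  by rewrite -mulam //; exact: fit.
have [phi [d [phiD od o0 oN phic]]] := adm.
pose E := chain g (maxn n m).
have nE : chain g n `<=` E by apply: chain_mono; exact: leq_maxl.
have [x [xo xE]] := G_fresh (cS _ : is_subgroup E) (cF _) o0 oN.
have [] := @realization _ _ _ r lam (chain g n) E phi d x o (2 * e) hr vl lr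
   (in_class_bound (is_GrN_class GV)) (cS _) (cS _) (cF _) nE phiD _ _ o0 od xo xE.
- by rewrite mulr_gt0.
- move=> a na; have := phic a 0%N na o0; have := fit a na.
  by rewrite mulr0n addr0 !ler_norml => /andP[? ?] /andP[? ?]; apply/andP; split; lra.
move=> lam' [vl' lr' lE lS].
have [k kP] := chain_absorb g_surj G_torsion (adjoin_finite o0 xo (cF n)).
exists lam', k; split=> // [z mz|mu muE _ _].
  by apply: lE; apply: chain_mono mz; exact: leq_maxr.
exists x => // a j na jo; rewrite muE; last by apply: kP; exists a, j.
have := lS a j na; have := phic a j na jo.
by rewrite !ler_norml ltr_norml => /andP[? ?] /andP[? ?]; apply/andP; split; lra.
Qed.

Lemma forced_open n o c e (lam : values r G) : forced n o c e (value_fun lam) ->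
  nbhs lam [set mu | forced n o c e (value_fun mu)].
Proof.
have near_lt (x : G) (b : R) (A : set R) : open A -> A (value_fun lam x) ->
    nbhs lam [set mu : values r G | A (value_fun mu x)].
  by move=> oA Ax; apply: (@value_fun_continuous _ _ _ x lam); exact: open_nbhs_nbhs.
have [adm|nadm] := pselect (admissible n o c e); last first.
  by move=> _; apply: filterE => mu adm; case: nadm.
have [fit|/existsNP[a]] := pselect (fits (value_fun lam) n c e); last first.
  move=> /not_implyP[na /negP]; rewrite -ltNge => lac _.
  have : nbhs lam [set mu : values r G | e < `|value_fun mu a - c a 0%N|].
    apply: (@near_lt a 0 [set t | e < `|t - c a 0%N|]) => //.
    apply: open_comp (@open_gt _ e) => t _.
    apply: (@continuous_comp _ _ _ (fun t => t - c a 0%N) Num.norm).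
      by apply: continuousB; [exact: cvg_id|exact: cst_continuous].
    exact: norm_continuous.
  by apply: filterS => mu /= muac _ /(_ _ na); rewrite leNgt muac.
move=> /(_ adm fit)[x xo xP].
have : nbhs lam [set mu : values r G | forall p : G * nat,
    (chain g n `*` `I_o) p -> `|value_fun mu (p.1 + x *+ p.2) - c p.1 p.2| < 4 * e].
  apply: near_finite; first exact: finite_setX (cF n) (finite_II o).
  move=> [a k] [/= na ko].
  apply: (@near_lt _ 0 [set t | `|t - c a k| < 4 * e]); last exact: xP.
  apply: open_comp (@open_lt _ (4 * e)) => t _.
  apply: (@continuous_comp _ _ _ (fun t => t - c a k) Num.norm).
    by apply: continuousB; [exact: cvg_id|exact: cst_continuous].
  exact: norm_continuous.
apply: filterS => mu /= muP _ _; exists x => // a k na ko.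
exact: (muP (a, k)).
Qed.

Variable idx : G -> nat.

Definition tolerance (k : nat) : R := k.+1%:R^-1.

(** A table for a finite subgroup is coded by a list of lists of rationals, with
    rows indexed by a numbering [idx] of [G]; the default values of [nth] fill
    the entries outside of the list. *)
Definition decode (c : seq (seq rat)) (x : G) (k : nat) : R :=
  ratr (nth [::] c (idx x))`_k.

Definition generic_condition (j : nat) : set (G -> R) :=
  if choice.unpickle j is Some (n, o, c, k) then forced n o (decode c) (tolerance k)
  else setT.

Lemma generic_condition_dense j lam m :
  is_value lam -> (forall x, ((lam x)%:E <= r)%E) ->
  exists lam' m', [/\ is_value lam', forall x, ((lam' x)%:E <= r)%E,
    forall x, chain g m x -> lam' x = lam x &
    forall mu, (forall x, chain g m' x -> mu x = lam' x) ->
      generic_condition j mu].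
Proof.
rewrite /generic_condition; case: choice.unpickle => [[[[n o] c] k]|] vl lr.
  by apply: forced_dense => //; rewrite invr_gt0.
by exists lam, m.
Qed.

Lemma generic_condition_open j (lam : values r G) :
  generic_condition j (value_fun lam) ->
  nbhs lam [set mu | generic_condition j (value_fun mu)].
Proof.
rewrite /generic_condition; case: choice.unpickle => [[[[n o] c] k]|].
  exact: forced_open.
by move=> _; exact: filterE.
Qed.

Definition generic : set (values r G) :=
  [set lam | forall j, generic_condition j (value_fun lam)].

Lemma generic_dense : dense generic.
Proof.
move=> W [lam Wlam] oW.
have /choice[mu muP] (n : nat) : exists mu : values r G, generic mu /\
    forall x, chain g n x -> value_fun mu x = value_fun lam x.
  have [mu [vm mr mE mP]] := fusion g_surj G_torsion n
    (fun j mu n => generic_condition_dense j n) (value_fun_is_value lam)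
    (value_fun_bound lam).
  by have [nu nuE] := value_fun_surj vm mr; exists nu; rewrite /generic /= nuE.
have [|x|k Wk] := pointwise_eventually (lam := lam) (mu := mu) (W := W).
- exact: open_nbhs_nbhs.
- have [n nx] := chain_cover g_surj G_torsion x; exists n => k nk.
  by apply: (muP k).2; exact: chain_mono nx.
- by exists (mu k); split=> //; exact: (muP k).1.
Qed.

(** By [generic_condition_open] and [generic_dense], no neighborhood of
    a generic value is contained in the closure of the set where a given
    condition fails. *)
Lemma generic_comeager (F : set (values r G)) : generic `<=` F -> comeager F.
Proof.
move=> gF.
exists (fun j => ~` F `&` [set lam | ~ generic_condition j (value_fun lam)]).
  move=> j; rewrite /nowhere_dense -subset0 => lam /= intB.
  have [mu [cmu mug]] := generic_dense (ex_intro _ lam intB) (open_interior _).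
  have [nu [[_ nuj] nuG]] := interior_subset cmu _ (generic_condition_open (mug j)).
  exact: nuj.
apply/seteqP; split=> [lam Flam|lam [j _ []]//].
apply: contrapT => nB; apply: (Flam); apply: gF => j; apply: contrapT => nj.
by apply: nB; exists j.
Qed.

End generic.

(** * Limits in a valued group *)

Section limits.
Variables (R : realType) (V : valuedZmodType R).

Lemma open_nbhs_ball (v : V) (e : R) : 0 < e ->
  open_nbhs (v : metric_of V) ((ball (v : metric_of V) e)°).
Proof.
by move=> e0; split; [exact: open_interior|exact: nbhsx_ballx].
Qed.

Lemma dense_approx (D : set (metric_of V)) (v : V) (e : R) :
  dense D -> 0 < e -> exists2 t : V, D t & value (v - t) < e.
Proof.
move=> dD e0; have [oB vB] := open_nbhs_ball v e0.
have [t [Bt Dt]] := dD _ (ex_intro _ v vB) oB.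
by exists t => //; have := interior_subset Bt; rewrite ballEmdist.
Qed.

Lemma complete_limit (u : nat -> V) : complete_space (metric_of V) ->
  u \in @cauchy_seq R V -> exists l, value (u n - l) @[n --> \oo] --> (0 : R).
Proof.
move=> cV /asboolP cu; have [l ul] := cV _ _ cu.
exists l; apply/cvgrPdist_lt => e e0; near=> n.
rewrite sub0r normrN ger0_norm ?value_ge0 // valueBC.
have : ball (l : metric_of V) e (u n).
  by near: n; apply: ul; exact: nbhsx_ballx.
by rewrite ballEmdist.
Unshelve. all: by end_near. Qed.

Lemma limitP (u : nat -> V) (l : V) : value (u n - l) @[n --> \oo] --> (0 : R) <->
  forall e : R, 0 < e -> exists n, forall k, (n <= k)%N -> value (u k - l) < e.
Proof.
split=> [ul e e0|h].
  have /cvgrPdist_lt/(_ _ e0)[n _ nP] := ul.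
  exists n => k /nP /=; by rewrite sub0r normrN ger0_norm ?value_ge0.
apply/cvgrPdist_lt => e e0; have [n nP] := h _ e0.
by exists n => // k /nP /=; rewrite sub0r normrN ger0_norm ?value_ge0.
Qed.

Lemma limitD (u v : nat -> V) l m :
  value (u n - l) @[n --> \oo] --> (0 : R) ->
  value (v n - m) @[n --> \oo] --> (0 : R) ->
  value (u n + v n - (l + m)) @[n --> \oo] --> (0 : R).
Proof.
move=> ul vm; have h := cvgD (FF := eventually_filter) ul vm; rewrite addr0 in h.
refine (squeeze_cvgr _ (cvg_cst 0) h); apply: nearW => n /=.
by rewrite value_ge0 opprD addrACA valueD.
Qed.

Lemma limitB (u v : nat -> V) l m :
  value (u n - l) @[n --> \oo] --> (0 : R) ->
  value (v n - m) @[n --> \oo] --> (0 : R) ->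
  value (u n - v n - (l - m)) @[n --> \oo] --> (0 : R).
Proof.
move=> ul vm; apply: limitD => //.
have -> // : (fun n => value (- v n - - m) : R) = (fun n => value (v n - m)).
by apply/funext => n; rewrite -opprD valueN.
Qed.

Lemma limit_unique (u : nat -> V) l m :
  value (u n - l) @[n --> \oo] --> (0 : R) ->
  value (u n - m) @[n --> \oo] --> (0 : R) -> l = m.
Proof.
move=> ul um; have := limitB ul um.
have -> : (fun n => value (u n - u n - (l - m)) : R) = cst (value (l - m)).
  by apply/funext => n; rewrite subrr sub0r valueN.
move=> h; have lm0 := cvg_unique (@Rhausdorff R) (cvg_cst (value (l - m) : R)) h.
by apply/eqP; rewrite -subr_eq0; apply/eqP/(value_eq0 (l - m)); exact: lm0.
Qed.

Lemma limit_value (u : nat -> V) l :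
  value (u n - l) @[n --> \oo] --> (0 : R) ->
  value (u n) @[n --> \oo] --> (value l : R).
Proof.
move=> /limitP ul; apply/cvgrPdist_lt => e e0; have [n nP] := ul _ e0.
by exists n => // k /nP; apply: le_lt_trans; rewrite distrC value_dist.
Qed.

Lemma limit_le (u : nat -> V) l v (e : R) : value (u n - l) @[n --> \oo] --> (0 : R) ->
  (exists n, forall k, (n <= k)%N -> value (u k - v) <= e) -> value (l - v) <= e.
Proof.
move=> /limitP ul [n nP]; apply/ler_addgt0Pl => t t0; have [m mP] := ul _ t0.
rewrite -(subrKA (u (maxn n m))); apply: le_trans (valueD _ _) _.
apply: lerD; last by apply: nP; exact: leq_maxl.
by rewrite valueBC; apply/ltW/mP; exact: leq_maxr.
Qed.

Lemma separable_seq : separable_space (metric_of V) ->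
  exists e : nat -> V, forall v (t : R), 0 < t -> exists i, value (v - e i) < t.
Proof.
move=> [D cD dD]; have /countable_injP[f fI] := cD.
have /choice[e eP] (i : nat) : exists x : V, forall y, D y -> f y = i -> y = x.
  have [[x Dx fx]|nx] := pselect (exists2 x, D x & f x = i); last first.
    by exists 0 => y Dy fy; case: nx; exists y.
  by exists x => y Dy fy; apply: fI; rewrite ?inE ?fx ?fy.
exists e => v t t0; have [x Dx vx] := dense_approx v dD t0.
by exists (f x); rewrite -(eP _ _ Dx erefl).
Qed.

End limits.

(** * Back and forth *)

Section back_and_forth.
Variables (R : realType) (r : \bar R) (N : nat) (V : valuedZmodType R).
Variables (G : zmodType) (g : nat -> G).
Hypothesis hr : r = 1%E \/ r = +oo%E.
Hypothesis GV : is_GrN r N V.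
Hypothesis g_surj : forall x, exists n, g n = x.
Hypothesis G_torsion : forall x : G, exists2 o, (0 < o)%N & x *+ o = 0.
Hypothesis GN : forall x : G, x *+ N = 0.
Variable idx : G -> nat.
Hypothesis idxK : cancel idx g.
Variable lam : G -> R.
Hypothesis vl : is_value lam.
Hypothesis lr : forall x, ((lam x)%:E <= r)%E.
Hypothesis lam_gen : forall j, generic_condition N V g idx j lam.

Let cS := chain_subgroup g G_torsion.
Let cF := chain_finite g G_torsion.

Lemma decode_approx (A : set G) (q : G -> nat -> R) (o : nat) (e : R) :
  finite_set A -> 0 < e ->
  exists c, forall a k, A a -> (k < o)%N -> `|q a k - decode R idx c a k| <= e.
Proof.
move=> fA e0.
have /choice[f fP] (p : G * nat) : exists s : rat, `|q p.1 p.2 - ratr s| <= e.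
  have [s] : exists s, ratr s \in `](q p.1 p.2 - e), (q p.1 p.2 + e)[.
    by apply: rat_in_itvoo; lra.
  rewrite in_itv /= => /andP[? ?]; exists s; rewrite ler_norml; apply/andP; split; lra.
pose M := (\max_(x <- fset_set A) idx x).+1.
exists [seq [seq f (g i, k) | k <- iota 0 o] | i <- iota 0 M] => a k Aa ko.
have aM : (idx a < M)%N.
  by rewrite /M ltnS; apply: leq_bigmax_seq => //; rewrite in_fset_set // inE.
rewrite /decode (nth_map 0%N) ?size_iota // nth_iota // add0n.
by rewrite (nth_map 0%N) ?size_iota // nth_iota // add0n idxK; exact: fP (a, k).
Qed.

(** For positive [N], the number [N] itself serves as [o], whatever the order
    of [d]. *)
Lemma finite_order_exponent (d : V) : finite_order V d ->
  exists o, [/\ (0 < o)%N, (o %| N)%N & d *+ o = 0].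
Proof.
move=> [q q0 dq]; have [N0|N0] := posnP N; first by exists q; rewrite N0 dvdn0.
by exists N; split=> //; exact: in_class_exponent (is_GrN_class GV) d.
Qed.

(** Genericity, applied to the table of the values [value (phi a + d *+ k)],
    gives [x] such that the subgroup [S] generated by the graph of [phi] and
    by [(x, d)] is an approximate isometry; [is_GrN_amalgam] corrects it and
    extends it along the chain at the same time. *)
Lemma back_and_forth_step n (phi : G -> V) (d : V) (e : R) :
  additive_on (chain g n) phi -> isometric_on lam (chain g n) phi ->
  finite_order V d -> 0 < e ->
  exists n' (psi : G -> V), [/\ (n < n')%N, additive_on (chain g n') psi,
    isometric_on lam (chain g n') psi,
    forall a, chain g n a -> value (psi a - phi a) <= e &
    exists2 y, chain g n' y & value (psi y - d) <= e].
Proof.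
move=> phiD phil /finite_order_exponent[q [q0 qN dq]] e0.
(* The error in [S] is at most [4 * t] from genericity plus [t] from the
   rational approximation. *)
have e50 : 0 < e / 5 by rewrite divr_gt0.
have [k _ /(_ k (leqnn k)) /= ke] := near_infty_natSinv_lt (PosNum e50).
rewrite -/(tolerance R k) in ke; set t := tolerance R k in ke.
have t0 : 0 < t by rewrite invr_gt0.
have te : 5 * t <= e by move: ke; rewrite ltr_pdivlMr // mulrC => /ltW.
have [c cP] := decode_approx (fun a j => value (phi a + d *+ j)) q (cF n) t0.
have [x xq xP] : realizes g lam n q (decode R idx c) t.
  have := lam_gen (choice.pickle (n, q, c, k)).
  rewrite /generic_condition choice.pickleK; apply.
    by exists phi, d; split.
  by move=> a na; rewrite -phil //; have := cP a 0%N na q0; rewrite mulr0n addr0.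
pose S : set (G * V) := adjoin ((fun a => (a, phi a)) @` chain g n) (x, d).
have xdq : (x, d) *+ q = 0 by rewrite pairMnE /= xq dq.
have hS : is_subgroup S.
  by apply: adjoin_subgroup q0 xdq _; exact: graph_subgroup.
have fS : finite_set S.
  by apply: adjoin_finite q0 xdq _; apply: finite_image; exact: cF.
have SE b h : S (b, h) -> `|lam b - value h| <= e.
  move=> [_ [j [[a na <-]]]]; rewrite pairMnE => -[-> ->].
  rewrite -(mulrn_mod j xq) -(mulrn_mod j dq).
  have jq : (j %% q < q)%N by rewrite ltn_mod.
  have := xP _ _ na jq; have := cP _ _ na jq.
  by rewrite !ler_norml ltr_norml => /andP[? ?] /andP[? ?]; apply/andP; split; lra.
have [m mP] := chain_absorb g_surj G_torsion (finite_image fst fS).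
have [] := @is_GrN_amalgam _ r N V G lam S (chain g (maxn n.+1 m)) e hr GV vl lr GN
  (cS _) (cF _) hS fS _ e0 SE.
  move=> b h Sbh; apply: chain_mono (leq_maxr _ _) _ _.
  by apply: mP; exists (b, h).
move=> psi [psiD psil psiS].
exists (maxn n.+1 m), psi; split=> //; first exact: leq_maxl.
  by move=> a na; apply: psiS; apply: sub_adjoin; exists a.
exists x.
  apply: chain_mono (leq_maxr _ _) _ _; apply: mP; exists (x, d) => //.
  by apply: mem_adjoin; exact: graph_subgroup.
by apply: psiS; apply: mem_adjoin; exact: graph_subgroup.
Qed.

Lemma finite_order_approx (v : V) (e : R) : 0 < e ->
  exists2 t, finite_order V t & value (v - t) < e.
Proof.
move=> e0; have [N0|N0] := posnP N.
  have [t Dt vt] := dense_approx v (is_GrN_torsion GV N0) e0.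
  by exists t.
exists v; last by rewrite subrr value0.
by exists N => //; exact: in_class_exponent (is_GrN_class GV) v.
Qed.

(** Step [i] is run with error [h i = 2 ^ - i], so that the limit is within
    [2 * h i] of the [i]-th homomorphism. Its target [T i] is a torsion element
    close to the term of index [logn 2 i.+1] of a dense sequence: every index
    [j] occurs at arbitrarily late steps, namely for [i.+1 = 2 ^ j * 3 ^ l]. *)
Lemma back_and_forth : exists Phi : {additive G -> V},
  (forall x, value (Phi x) = lam x) /\
  forall v (e : R), 0 < e -> exists y, value (v - Phi y) < e.
Proof.
have [D DP] := separable_seq (in_class_separable (is_GrN_class GV)).
pose h i : R := 2^-1 ^+ i.
have h0 i : 0 < h i by rewrite exprn_gt0 // invr_gt0.
have hS i : h i.+1 + h i.+1 = h i.
  by rewrite /h exprS; lra.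
have /choice[T TP] i : exists t, finite_order V t /\
    value (D (logn 2 i.+1) - t) < h i.
  by have [t ? ?] := finite_order_approx (D (logn 2 i.+1)) (h0 i); exists t.
pose good (s : nat * (G -> V)) :=
  additive_on (chain g s.1) s.2 /\ isometric_on lam (chain g s.1) s.2.
have stp (t : nat * (nat * (G -> V))) : exists s : nat * (G -> V), good t.2 ->
    [/\ good s, (t.2.1 < s.1)%N,
      forall a, chain g t.2.1 a -> value (s.2 a - t.2.2 a) <= h t.1 &
      exists2 y, chain g s.1 y & value (s.2 y - T t.1) <= h t.1].
  have [[tD tl]|nt] := pselect (good t.2); last by exists t.2.
  have [n' [psi [? ? ? ? ?]]] := back_and_forth_step tD tl (TP t.1).1 (h0 t.1).
  by exists (n', psi).
have [F FP] := choice stp.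
pose s := fix s j := if j is j'.+1 then F (j', s j') else (0%N, fun=> 0).
have sgood j : good (s j).
  elim: j => [|j IH]; last by have [] := FP (j, s j) IH.
  split=> [x y _ _|x /= ->] /=; first by rewrite addr0.
  by rewrite value0 (is_value0 vl).
have sP j : [/\ ((s j).1 < (s j.+1).1)%N,
    forall a, chain g (s j).1 a -> value ((s j.+1).2 a - (s j).2 a) <= h j &
    exists2 y, chain g (s j.+1).1 y & value ((s j.+1).2 y - T j) <= h j].
  by have [] := FP (j, s j) (sgood j).
have s_ge j : (j <= (s j).1)%N.
  elim: j => // j IH; apply: leq_ltn_trans IH _; by have [] := sP j.
have s_mono i j : (i <= j)%N -> ((s i).1 <= (s j).1)%N.
  move=> /subnK <-; elim: (j - i)%N => // k IH.
  by apply: leq_trans IH (ltnW _); have [] := sP (k + i)%N.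
have s_close i j a : (i <= j)%N -> chain g (s i).1 a ->
    value ((s j).2 a - (s i).2 a) <= 2 * h i - 2 * h j.
  move=> /subnK <- ia; elim: (j - i)%N => [|k IH]; first by rewrite !subrr value0.
  have [_ /(_ a) + _] := sP (k + i)%N.
  have kia : chain g (s (k + i)%N).1 a.
    by apply: chain_mono ia; apply: s_mono; exact: leq_addl.
  move=> /(_ kia) step; rewrite addSn -(subrKA ((s (k + i)%N).2 a)).
  have := valueD ((s (k + i).+1).2 a - (s (k + i)%N).2 a)
    ((s (k + i)%N).2 a - (s i).2 a).
  have := hS (k + i)%N; lra.
have hlim (e : R) : 0 < e -> exists i, forall j, (i <= j)%N -> 4 * h j < e.
  move=> e0; have e40 : 0 < e / 4 by rewrite divr_gt0.
  have /cvgrPdist_lt/(_ _ e40)[i _ iP] : h @ \oo --> (0 : R).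
    by apply: cvg_expr; rewrite ger0_norm ?invr_ge0 // invf_lt1 // ltr1n.
  exists i => j /iP /=; rewrite sub0r normrN ger0_norm ?(ltW (h0 _)) //; lra.
have /choice[w wP] := chain_cover g_surj G_torsion.
have sw i a : (w a <= i)%N -> chain g (s i).1 a.
  by move=> wi; apply: chain_mono (wP a); exact: leq_trans wi (s_ge i).
have /choice[Phi PhiP] a : exists l, value ((s n).2 a - l) @[n --> \oo] --> (0 : R).
  apply: complete_limit (is_GrN_complete GV) _; apply/cauchy_seqP => e e0.
  have [i iP] := hlim _ e0; pose i' := maxn i (w a).
  exists i' => m n i'm i'n; rewrite -(subrKA ((s i').2 a)).
  have := valueD ((s m).2 a - (s i').2 a) ((s i').2 a - (s n).2 a).
  rewrite [X in _ <= _ + X]valueBC.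
  have ia : chain g (s i').1 a by apply: sw; exact: leq_maxr.
  have := s_close _ _ _ i'm ia; have := s_close _ _ _ i'n ia.
  have := iP i' (leq_maxl _ _); have := h0 m; have := h0 n; lra.
have PhiD x y : Phi (x + y) = Phi x + Phi y.
  apply: limit_unique (PhiP _) _.
  have /limitP h1 := limitD (PhiP x) (PhiP y).
  apply/limitP => e /h1[n nP]; pose m := maxn n (maxn (w x) (w y)).
  exists m => k mk; rewrite (sgood k).1; last 2 first.
  - by apply: sw; apply: leq_trans mk; rewrite /m !leq_max leqnn orbT.
  - by apply: sw; apply: leq_trans mk; rewrite /m !leq_max leqnn !orbT.
  by apply: nP; apply: leq_trans mk; exact: leq_maxl.
have PhiB : additive Phi.
  move=> x y; apply/eqP; rewrite eq_sym subr_eq -PhiD subrK; exact/eqP.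
pose PhiA : {additive G -> V} :=
  HB.pack Phi (GRing.isZmodMorphism.Build _ _ Phi PhiB).
exists PhiA.
split=> [x|v e e0] /=.
  have := limit_value (PhiP x) => h1; apply: cvg_unique h1 _ => //.
  apply/cvgrPdist_lt => e e0; exists (w x) => // k /= wk.
  by rewrite (sgood k).2 ?subrr ?normr0 //; exact: sw.
have e20 : 0 < e / 2 by rewrite divr_gt0.
have [j jP] := DP v _ e20; have [l lP] := hlim _ e20.
pose i := (2 ^ j * 3 ^ l).-1.
have iS : i.+1 = (2 ^ j * 3 ^ l)%N by rewrite prednK // muln_gt0 !expn_gt0.
have il : (l <= i)%N.
  rewrite -ltnS iS; apply: leq_trans (ltn_expl l (isT : 1 < 3)%N) _.
  by rewrite leq_pmull // expn_gt0.
have ij : logn 2 i.+1 = j.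
  rewrite iS lognM ?expn_gt0 // !lognX logn_prime // muln1.
  by rewrite (_ : logn 2 3 = 0)%N // muln0 addn0.
have [_ _ [y yi yT]] := sP i; exists y.
have /= := (TP i).2; rewrite ij => DT.
have PhiT : value (Phi y - (s i.+1).2 y) <= 2 * h i.+1.
  apply: limit_le (PhiP y) _; exists i.+1 => k ik.
  by have := s_close _ _ _ ik yi; have := h0 k; lra.
have := lP _ il; have := hS i.
have := valueD (v - D j) (D j - Phi y); rewrite subrKA.
have := valueD (D j - T i) (T i - Phi y); rewrite subrKA.
have := valueD (T i - (s i.+1).2 y) ((s i.+1).2 y - Phi y); rewrite subrKA.
rewrite [value (T i - (s i.+1).2 y)]valueBC.
rewrite [value ((s i.+1).2 y - Phi y)]valueBC; lra.
Qed.

End back_and_forth.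

(** * The completion of a group with a dense isometric image *)

Section completion_map.
Variables (R : realType) (W V : valuedZmodType R).

Lemma cauchy_isometry (Phi : {additive W -> V}) (u : nat -> W) :
  isometric Phi -> (Phi \o u \in @cauchy_seq R V) = (u \in @cauchy_seq R W).
Proof.
move=> iPhi; apply/cauchy_seqP/cauchy_seqP => h e /h[n nP]; exists n => i j ni nj.
  by have := nP i j ni nj; rewrite /= -raddfB iPhi.
by have := nP i j ni nj; rewrite /= -raddfB iPhi.
Qed.

Lemma limit_cauchy (u : nat -> V) l :
  value (u n - l) @[n --> \oo] --> (0 : R) -> u \in @cauchy_seq R V.
Proof.
move=> /limitP ul; apply/cauchy_seqP => e e0.
have [|n nP] := ul (e / 2); first by rewrite divr_gt0.
exists n => i j /nP ni /nP nj; rewrite -(subrKA l).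
by have := valueD (u i - l) (l - u j); rewrite [value (l - _)]valueBC; lra.
Qed.

(** The map sends the class of a Cauchy sequence [u] to the limit of [Phi \o u].
    It is isometric because values pass to the limit, hence injective; density
    of the image of [Phi] makes it onto. *)
Lemma completion_iso (Phi : {additive W -> V}) :
  complete_space (metric_of V) -> isometric Phi ->
  (forall v (e : R), 0 < e -> exists y, value (v - Phi y) < e) ->
  isometrically_isomorphic (completion W) V.
Proof.
move=> cV iPhi dPhi.
have /choice[f fP] (x : completion W) : exists l,
    value (Phi (cauchy_val (repr x) n) - l) @[n --> \oo] --> (0 : R).
  apply: complete_limit cV _.
  by rewrite (cauchy_isometry _ iPhi); exact: (valP (repr x)).
have fpi (u : cauchy_group W) :
    value (Phi (cauchy_val u n) - f (\pi_(completion W) u)%qT) @[n --> \oo] --> (0 : R).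
  set x := (\pi_(completion W) u)%qT.
  have /asboolP ux : u - repr x \in @null_seq R W.
    by rewrite Quotient.idealrBE reprK.
  have ux' : value (Phi (cauchy_val u n) - Phi (cauchy_val (repr x) n) - 0)
      @[n --> \oo] --> (0 : R).
    have -> // : (fun n => value (Phi (cauchy_val u n) -
        Phi (cauchy_val (repr x) n) - 0) : R) =
      (fun n => value (cauchy_val (u - repr x) n)).
    by apply/funext => n; rewrite subr0 -raddfB iPhi.
  have := limitD ux' (fP x); rewrite add0r.
  have -> // : (fun n => value (Phi (cauchy_val u n) -
    Phi (cauchy_val (repr x) n) + Phi (cauchy_val (repr x) n) - f x) : R) =
    (fun n => value (Phi (cauchy_val u n) - f x)).
  by apply/funext => n; rewrite subrK.
have fB : additive f.
  move=> x y; rewrite -[x]reprK -[y]reprK; set u := repr x; set v := repr y.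
  rewrite -(@pi_oppr _ _ _ _ _ (Quotient.quot _)).
  rewrite -(@pi_addr _ _ _ _ _ (Quotient.quot _)).
  apply: limit_unique (fpi _) _.
  have := limitB (fpi u) (fpi v).
  have -> // : (fun n => value (Phi (cauchy_val u n) - Phi (cauchy_val v n) -
      (f (\pi_(completion W) u)%qT - f (\pi_(completion W) v)%qT)) : R) =
    (fun n => value (Phi (cauchy_val (u - v) n) -
      (f (\pi_(completion W) u)%qT - f (\pi_(completion W) v)%qT))).
  by apply/funext => n; rewrite -raddfB.
have fi x : value (f x) = value x.
  rewrite -[x]reprK; set u := repr x.
  have c1 := limit_value (fpi u); have c2 := @cvg_completion_value R W u.
  have uE : (fun n => value (Phi (cauchy_val u n)) : R) =
    (fun n => value (cauchy_val u n)) by apply/funext => n; rewrite iPhi.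
  by rewrite uE in c1; exact: (cvg_unique (@Rhausdorff R) c1 c2).
pose fA : {additive completion W -> V} :=
  HB.pack f (GRing.isZmodMorphism.Build _ _ f fB).
exists fA => //.
have finj x y : f x = f y -> x = y.
  move=> fxy; apply/eqP; rewrite -subr_eq0; apply/eqP.
  apply/(value_eq0 (x - y)); rewrite -fi.
  by rewrite (_ : f (x - y) = 0) ?value0 // fB fxy subrr.
have fsurj v : exists x, f x = v.
  have /choice[u uP] (n : nat) : exists y, value (v - Phi y) < (harmonic n : R).
    by apply: dPhi; exact: harmonic_gt0.
  have uv : value (Phi (u n) - v) @[n --> \oo] --> (0 : R).
    apply: squeeze_cvgr (cvg_cst 0) (@cvg_harmonic R).
    by apply: nearW => n; rewrite value_ge0 valueBC ltW.
  have cu : u \in @cauchy_seq R W.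
    by rewrite -(cauchy_isometry _ iPhi); exact: limit_cauchy uv.
  exists (\pi_(completion W) (CauchyGroup cu))%qT.
  exact: limit_unique (fpi (CauchyGroup cu)) uv.
have /choice[h hP] := fsurj.
by exists h => [x|v]; [apply: finj; rewrite hP|rewrite /= hP].
Qed.

End completion_map.

(** * Generic values on countable torsion groups *)

Section generic_completion.
Variables (R : realType) (r : \bar R) (N : nat) (V : valuedZmodType R).
Variables (G : zmodType).
Hypothesis hr : r = 1%E \/ r = +oo%E.
Hypothesis GV : is_GrN r N V.
Hypothesis G_countable : countable [set: G].
Hypothesis G_torsion : forall x : G, exists2 o, (0 < o)%N & x *+ o = 0.
Hypothesis GN : forall x : G, x *+ N = 0.
Hypothesis G_fresh : forall (A : set G) o, is_subgroup A -> finite_set A ->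
  (0 < o)%N -> (o %| N)%N ->
  exists x, x *+ o = 0 /\ forall k, A (x *+ k) -> (o %| k)%N.

(** Every generic value has the required completion, by [back_and_forth] and
    [completion_iso], so the set contains the generic values. *)
Lemma generic_completion :
  let F : set (values r G) :=
    [set lam | isometrically_isomorphic (completion (valued lam)) V] in
  dense F /\ comeager F.
Proof.
have /countable_injP[idx idxI] := G_countable.
have idxinj x y : idx x = idx y -> x = y by apply: idxI; rewrite inE.
(* [g] is a left inverse of the numbering [idx], hence onto. *)
have /choice[g gP] (n : nat) : exists y, forall x, idx x = n -> x = y.
  have [[y yn]|nn] := pselect (exists y, idx y = n).
    by exists y => x xn; apply: idxinj; rewrite yn.
  by exists 0 => x xn; case: nn; exists x.
have idxK : cancel idx g by move=> x; rewrite -(gP _ x erefl).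
have g_surj x : exists n, g n = x by exists (idx x).
move=> F.
have gF : generic N V g idx `<=` F.
  move=> lam lam_gen.
  have [Phi [Phii Phid]] := back_and_forth hr GV g_surj G_torsion GN idxK
    (value_fun_is_value lam) (value_fun_bound lam) lam_gen.
  exact: (@completion_iso R (valued lam) V Phi (is_GrN_complete GV)).
split; last first.
  exact: (generic_comeager hr GV g_surj G_torsion G_fresh gF).
move=> W W0 oW; have [lam [Wl gl]] :=
  generic_dense hr GV g_surj G_torsion G_fresh idx W0 oW.
by exists lam; split=> //; exact: gF.
Qed.

End generic_completion.

(** * The groups Gamma_N *)

Section countable_sum_theory.
Variable C : zmodType.
Implicit Types f : countable_sum C.

Lemma countable_sum_ext f (h : countable_sum C) : (forall n, f n = h n) -> f = h.
Proof. by move=> fh; apply/val_inj/funext. Qed.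

Lemma countable_sum_mulrn f k n : (f *+ k) n = f n *+ k.
Proof. by elim: k => // k IH; rewrite !mulrS -IH. Qed.

Lemma countable_sum_support_bound f : exists K, forall n, (K <= n)%N -> f n = 0.
Proof.
have /asboolP fF := valP f.
exists (\max_(n <- fset_set [set n | f n <> 0]) n).+1 => n Kn.
apply: contrapT => fn; move: Kn; apply/negP; rewrite -ltnNge ltnS.
by apply: leq_bigmax_seq => //; rewrite in_fset_set // inE.
Qed.

Lemma countable_sum_torsion : (forall c : C, exists2 o, (0 < o)%N & c *+ o = 0) ->
  forall f, exists2 o, (0 < o)%N & f *+ o = 0.
Proof.
move=> Ct f; have [K fK] := countable_sum_support_bound f.
have /choice[q qP] (c : C) : exists k, (0 < k)%N /\ c *+ k = 0.
  by have [k] := Ct c; exists k.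
exists (\prod_(i < K) q (f i))%N.
  by rewrite prodn_gt0 // => i; exact: (qP _).1.
apply: countable_sum_ext => n; rewrite countable_sum_mulrn; have [/fK ->|nK] := leqP K n.
  by rewrite mul0rn.
by rewrite (bigD1 (Ordinal nK)) //= mulrnA (qP _).2 mul0rn.
Qed.

Lemma countable_sum_exponent N : (forall c : C, c *+ N = 0) -> forall f, f *+ N = 0.
Proof. by move=> CN f; apply: countable_sum_ext => n; rewrite countable_sum_mulrn CN. Qed.

(** A finitely supported sequence is coded by its initial segment of length [K],
    a bound of its support; the code determines this length. *)
Lemma countable_sum_countable : countable [set: C] -> countable [set: countable_sum C].
Proof.
move=> /countable_injP[c cI]; have /choice[K KP] := countable_sum_support_bound.
have cinj x y : c x = c y -> x = y by apply: cI; rewrite inE.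
apply/countable_injP.
exists (fun f => choice.pickle [seq c (f i) | i <- iota 0 (K f)]) => f h _ _.
move=> /(pcan_inj choice.pickleK) fh.
have Kfh : K f = K h.
  by have := congr1 size fh; rewrite !size_map !size_iota.
apply: countable_sum_ext => n; have [nK|nK] := leqP (K f) n.
  by rewrite !KP -?Kfh.
have /= := congr1 (nth 0%N ^~ n) fh.
by rewrite -Kfh !(nth_map 0%N) ?size_iota // nth_iota // add0n => /cinj.
Qed.

(** A finite subgroup is supported on finitely many coordinates; an element
    supported on another coordinate is independent of it. *)
Lemma countable_sum_fresh N : (forall o, (0 < o)%N -> (o %| N)%N ->
    exists c : C, forall k, c *+ k = 0 <-> (o %| k)%N) ->
  forall (A : set (countable_sum C)) o, is_subgroup A -> finite_set A ->
  (0 < o)%N -> (o %| N)%N ->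
  exists x, x *+ o = 0 /\ forall k, A (x *+ k) -> (o %| k)%N.
Proof.
move=> CO A q _ fA q0 qN; have [c cP] := CO q q0 qN.
have /choice[K KP] := countable_sum_support_bound.
pose M := \max_(f <- fset_set A) K f.
have AM f : A f -> f M = 0.
  by move=> Af; apply: KP; apply: leq_bigmax_seq => //; rewrite in_fset_set // inE.
have hx : (fun n => if n == M then c else 0) \in @finitely_supported C.
  apply/asboolP; apply: sub_finite_set (finite_set1 M) => n /=.
  by case: eqP.
exists (CountableSum hx); split.
  apply: countable_sum_ext => n; rewrite countable_sum_mulrn /=.
  case: ifP => _; last by rewrite mul0rn.
  exact/cP.
by move=> k /AM; rewrite countable_sum_mulrn /= eqxx => /cP.
Qed.

End countable_sum_theory.

Section rational_circle.
Local Open Scope quotient_scope.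

Lemma rat_mod_int_pi0 (x : rat) :
  \pi_rat_mod_int x = 0 :> rat_mod_int <-> x \is a Num.int.
Proof.
rewrite -(@pi_zeror _ _ _ _ _ (Quotient.quot integral_rat)).
split=> [/eqP|xi]; first by rewrite -Quotient.idealrBE subr0.
by apply/eqP; rewrite -Quotient.idealrBE subr0.
Qed.

Lemma rat_mod_int_piMn (x : rat) k :
  (\pi_rat_mod_int x : rat_mod_int) *+ k = \pi_rat_mod_int (x *+ k).
Proof.
elim: k => [|k IH]; first by rewrite !mulr0n; exact/esym/rat_mod_int_pi0.
by rewrite !mulrS IH -(@pi_addr _ _ _ _ _ (Quotient.quot integral_rat)).
Qed.

Lemma rat_mod_int_torsion (c : rat_mod_int) : exists2 o, (0 < o)%N & c *+ o = 0.
Proof.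
rewrite -[c]reprK; set x := repr c; exists `|denq x|%N.
  by rewrite absz_gt0 denq_neq0.
rewrite rat_mod_int_piMn; apply/rat_mod_int_pi0.
rewrite pmulrn absz_denq -mulrzr -numqE; exact: intr_int.
Qed.

Lemma rat_mod_int_order q : (0 < q)%N ->
  exists c : rat_mod_int, forall k, c *+ k = 0 <-> (q %| k)%N.
Proof.
move=> q0; have qn0 : (q%:R : rat) != 0 by rewrite pnatr_eq0 -lt0n.
exists (\pi_rat_mod_int (q%:R^-1 : rat)) => k.
rewrite rat_mod_int_piMn rat_mod_int_pi0 -(mulr_natl _ k); split.
  move=> /intrP[m kqm]; have km := canRL (mulfVK qn0) kqm.
  have : (k%:Z = m * q%:Z)%R.
    by apply/eqP; rewrite -(eqr_int rat) intrM /= !pmulrn in km *; rewrite km.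
  by move=> kmq; have : (q%:Z %| k%:Z)%Z by rewrite kmq dvdz_mull.
by move=> /dvdnP[m ->]; rewrite natrM mulfK //; exact: natr_int.
Qed.

Lemma rat_mod_int_countable : countable [set: rat_mod_int].
Proof.
apply/countable_injP; exists (fun c : rat_mod_int => choice.pickle (repr c)).
move=> x y _ _ /(pcan_inj choice.pickleK) xy.
by rewrite -[x]reprK -[y]reprK xy.
Qed.

End rational_circle.

Section cyclic.

Lemma Zp_order N q : (1 < N)%N -> (0 < q)%N -> (q %| N)%N ->
  exists c : 'Z_N, forall k, c *+ k = 0 <-> (q %| k)%N.
Proof.
move=> N1 q0 qN; have [m Nm] := dvdnP qN; exists m%:R => k.
have m0 : (0 < m)%N by move: N1; rewrite Nm; case: m {Nm}.
rewrite -mulrnA; have E := val_Zp_nat N1 (m * k).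
split=> [mk|/dvdnP[l ->]].
  move: E; rewrite mk /= => /esym/eqP; rewrite -/(dvdn _ _) Nm.
  by rewrite dvdn_pmul2l.
by rewrite mulnCA -Nm natrM pchar_Zp // mulr0.
Qed.

Lemma Zp_exponent N (c : 'Z_N) : (1 < N)%N -> c *+ N = 0.
Proof. by move=> N1; rewrite -mulr_natr pchar_Zp // mulr0. Qed.

End cyclic.

Section Gamma_properties.
Variable N : nat.
Hypothesis N1 : N <> 1%N.

Lemma Gamma_countable : countable [set: Gamma N].
Proof.
case: N N1 => [|n] _ /=; first exact: countable_sum_countable rat_mod_int_countable.
by apply: countable_sum_countable; exact: countableP.
Qed.

Lemma Gamma_exponent (x : Gamma N) : x *+ N = 0.
Proof.
case: N N1 x => [|[|n]] // _ x.
by apply: countable_sum_exponent x => c; exact: Zp_exponent.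
Qed.

Lemma Gamma_torsion (x : Gamma N) : exists2 o, (0 < o)%N & x *+ o = 0.
Proof.
have [N0|N0] := posnP N; last by exists N => //; exact: Gamma_exponent.
move: x; rewrite N0 => x; exact: countable_sum_torsion rat_mod_int_torsion x.
Qed.

Lemma Gamma_fresh (A : set (Gamma N)) o : is_subgroup A -> finite_set A ->
  (0 < o)%N -> (o %| N)%N ->
  exists x, x *+ o = 0 /\ forall k, A (x *+ k) -> (o %| k)%N.
Proof.
case: N N1 A => [|[|n]] // _ A; apply: countable_sum_fresh => q q0 qN.
  exact: rat_mod_int_order.
exact: Zp_order.
Qed.

End Gamma_properties.

(** * Density and comeagerness *)

Theorem theorem3p2 (R : realType) (r : \bar R) (N : nat)
    (hr : r = 1%E \/ r = +oo%E) (hN : N <> 1%N)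
    (GrN : valuedZmodType R) (hGrN : is_GrN r N GrN) :
  let F : set (values r (Gamma N)) :=
    [set lambda | isometrically_isomorphic (completion (valued lambda)) GrN] in
  dense F /\ comeager F.
Proof.
exact: (generic_completion hr hGrN (Gamma_countable hN) (Gamma_torsion hN)
  (Gamma_exponent hN) (Gamma_fresh hN)).
Qed.
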